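(* Let $a,b\in{}^\bullet\mathbb{R}$ with ${}^\circ a<{}^\circ b$, let $f:[a,b]\to{}^\bullet\mathbb{R}$ be a smooth function, and let $u\in[a,b]$. Then there exists one and only one smooth function $I:[a,b]\to{}^\bullet\mathbb{R}$ such that $I'(x)=f(x)$ for all $x\in[a,b]$ and $I(u)=0$.
   Context: Fermat reals: let $\mathbb{R}_o[t]$ be the set of maps $x:\mathbb{R}_{\ge0}\to\mathbb{R}$, $t\mapsto x_t$, of the form $x_t=r+\sum_{i=1}^k\alpha_i t^{a_i}+o(t)$ as $t\to0^+$, with $k\in\mathbb{N}$, $r,\alpha_i\in\mathbb{R}$, $a_i\in\mathbb{R}_{\ge0}$. Write $x\sim y$ iff $x_t=y_t+o(t)$ as $t\to0^+$. The ring of Fermat reals is ${}^\bullet\mathbb{R}:=\mathbb{R}_o[t]/\sim$ with pointwise operations; $\mathbb{R}\subseteq{}^\bullet\mathbb{R}$ via constants. The standard part of $x=[x_t]$ is ${}^\circ x:=x_0$ (componentwise on ${}^\bullet\mathbb{R}^n$). ${}^\bullet\mathbb{R}$ is totally ordered by: $x\le y$ iff for representatives there is $z\in\mathbb{R}_o[t]$ with $z\sim0$ and $x_t\le y_t+z_t$ for all small $t\ge0$; $[a,b]:=\{x\in{}^\bullet\mathbb{R}:a\le x\le b\}$. The Fermat topology on ${}^\bullet\mathbb{R}^n$ has open sets ${}^\bullet V:=\{x:{}^\circ x\in V\}$, $V\subseteq\mathbb{R}^n$ open. For $\alpha\in C^\infty(W,\mathbb{R}^m)$, $W\subseteq\mathbb{R}^d$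 open, ${}^\bullet\alpha:{}^\bullet W\to{}^\bullet\mathbb{R}^m$, ${}^\bullet\alpha([x_t]):=[\alpha(x_t)]$. A map $f:S\to{}^\bullet\mathbb{R}^m$, $S\subseteq{}^\bullet\mathbb{R}^n$, is smooth (quasi-standard smooth) if for every $x\in S$ there exist open $V\subseteq\mathbb{R}^n$ with $x\in{}^\bullet V$, open $P\subseteq\mathbb{R}^{\mathsf p}$, $p\in{}^\bullet P$ and $\alpha\in C^\infty(P\times V,\mathbb{R}^m)$ with $f(y)={}^\bullet\alpha(p,y)$ for all $y\in{}^\bullet V\cap S$. For $f$ smooth on a non-infinitesimal interval $J$ (endpoints with distinct standard parts) and $x\in J$, the derivative is $f'(x):={}^\bullet(\partial_2\alpha)(p,x)$ for any such local representation of $f$ around $x$ (independent of the representation; equivalently $f'(x)=r(x,0)$ where $r$ is the unique smooth function with $f(x+h)=f(x)+h\,r(x,h)$ for all sufficiently small $h$ with $x+h\in J$). *)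

(* Defs.v *)
From HB Require Import structures.
From mathcomp Require Import all_boot all_order all_algebra.
From mathcomp Require Import all_classical all_reals all_analysis.
Set Implicit Arguments. Unset Strict Implicit. Unset Printing Implicit Defensive.
Import Order.TTheory GRing.Theory Num.Theory.
Import numFieldNormedType.Exports.
Local Open Scope classical_set_scope.
Local Open Scope ring_scope.

Section Fermat.
Variable R : realType.

(* w_t = o(t) as t -> 0^+, on the domain t >= 0 (forces w_0 = 0) *)
Definition is_o (w : R -> R) : Prop :=
  forall e : R, 0 < e -> exists2 d : R, 0 < d &
    forall t : R, 0 <= t -> t < d -> `|w t| <= e * t.

(* Representatives of Fermat reals are maps t |-> x_t; only t >= 0 matters. *)
Definition fequiv (x y : R -> R) : Prop := is_o (fun t => x t - y t).

Definition fermat (x : R -> R) : Prop :=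
  exists (r : R) (k : nat) (al aa : nat -> R),
    (forall i, 0 <= aa i) /\
    is_o (fun t => x t - (r + \sum_(1 <= i < k.+1) al i * t `^ aa i)).

Definition fermat_vec (p : nat) (q : R -> 'rV[R]_p) : Prop :=
  forall i : 'I_p, fermat (fun t => q t 0 i).

Definition fle (x y : R -> R) : Prop :=
  exists z : R -> R, fequiv z (fun _ => 0) /\
    exists2 d : R, 0 < d & forall t : R, 0 <= t -> t < d -> x t <= y t + z t.

Definition fint (a b : R -> R) : set (R -> R) :=
  [set x | fermat x /\ fle a x /\ fle x b].

Fixpoint ipartial (d : nat) (l : seq 'I_d) (g : 'rV[R]_d -> R) : 'rV[R]_d -> R :=
  if l is i :: l' then (fun z => derive (ipartial l' g) z (delta_mx 0 i)) else g.

Definition smooth_on (d : nat) (U : set 'rV[R]_d) (g : 'rV[R]_d -> R) : Prop :=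
  forall (l : seq 'I_d) (z : 'rV[R]_d), U z ->
    {for z, continuous (ipartial l g)} /\
    forall i : 'I_d, derivable (ipartial l g) z (delta_mx 0 i).

Definition pair_fun (p : nat) (al : 'rV[R]_p -> R -> R) : 'rV[R]_(p + 1) -> R :=
  fun z => al (lsubmx z) (rsubmx z 0 0).

Definition pair_set (p : nat) (P : set 'rV[R]_p) (V : set R) : set 'rV[R]_(p + 1) :=
  [set z | P (lsubmx z) /\ V (rsubmx z 0 0)].

Definition local_rep (S : set (R -> R)) (f : (R -> R) -> R -> R) (x : R -> R)
  (V : set R) (p : nat) (P : set 'rV[R]_p) (q : R -> 'rV[R]_p)
  (al : 'rV[R]_p -> R -> R) : Prop :=
  [/\ open V, V (x 0), open P, fermat_vec q & P (q 0)] /\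
  smooth_on (pair_set P V) (pair_fun al) /\
  (forall y, S y -> V (y 0) -> fequiv (f y) (fun t => al (q t) (y t))).

Definition fsmooth (S : set (R -> R)) (f : (R -> R) -> R -> R) : Prop :=
  (forall x, S x -> fermat (f x)) /\
  forall x, S x -> exists V p P q al, @local_rep S f x V p P q al.

Definition fderiv (S : set (R -> R)) (f : (R -> R) -> R -> R) (x d : R -> R) : Prop :=
  exists V p P q al, @local_rep S f x V p P q al /\
    fequiv d (fun t => derive1 (al (q t)) (x t)).

End Fermat.

(* Main.v *)
Require Import Defs.
From HB Require Import structures.
From mathcomp Require Import all_boot all_order all_algebra.
From mathcomp Require Import all_classical all_reals all_analysis.
From mathcomp Require Import ring lra.
Import Order.TTheory GRing.Theory Num.Theory.
Import numFieldNormedType.Exports.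
Local Open Scope classical_set_scope.
Local Open Scope ring_scope.

(** Along a Fermat real q_t the Taylor expansion of al(q_t, y) in the parameters
    turns every smooth map, locally, into a finite sum of c_e(y) t^e with
    exponents e in [0, 1] and ordinary smooth coefficients c_e, up to o(t)
    uniformly in y. The coefficients are determined by the values at the real
    points of ]a 0, b 0[, so these local forms glue to a global one on a
    neighbourhood of [a 0, b 0], and f is integrated coefficientwise. If J' = f,
    the coefficients of J and of the primitive have the same derivative on
    ]a 0, b 0[; there they differ by constants, and at the endpoints the
    difference is flat, hence negligible along Fermat reals. *)

Set Implicit Arguments.
Unset Strict Implicit.

(** * Little-o estimates at 0+, uniform in a second variable *)

Section LittleO.
Variable R : realType.
Implicit Types (B : set R) (e : R) (w H : R -> R -> R).

(** Local representations of f use parameter spaces of different dimensions and agree only up to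
    o(t), so primitives of the separate maps al(p, .) cannot be patched directly. The normal form
    has no parameters, and capping its exponents at 1 makes the coefficients unique, because no
    nontrivial combination of powers t^e with 0 <= e <= 1 is o(t). The price is a way back:
    smoothness of the primitive must again be witnessed by a parametrised map, and for this the
    powers t^e themselves serve as parameters, in which the normal form is linear. A derivative is
    defined through an arbitrary representation, so al and its y-derivative must be expanded with
    matching coefficients. Real constants are certain to lie in [a, b] only strictly between [a 0]
    and [b 0]; uniqueness is therefore silent outside that interval although the coefficients live
    on a neighbourhood of it, which is why the endpoints need an argument of their own. *)

Definition at0 : set_system R := within [set t | 0 <= t] (nbhs (0 : R)).

Global Instance at0_filter : Filter at0.
Proof. exact: within_filter. Qed.

Lemma at0P (P : R -> Prop) : (\forall t \near at0, P t) <->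
  exists2 d, 0 < d & forall t, 0 <= t -> t < d -> P t.
Proof.
split=> [/nbhs_ballP[d d0 Pd]|[d d0 Pd]].
  exists d => // t t0 td; apply: Pd => //.
  by rewrite /ball/= sub0r normrN ger0_norm.
apply/nbhs_ballP; exists d => // t /=.
rewrite /ball/= sub0r normrN => td t0; apply: Pd => //.
by rewrite -(ger0_norm t0).
Qed.

Lemma at0_ge0 : \forall t \near at0, 0 <= t.
Proof. by apply/at0P; exists 1. Qed.

Lemma at0_lt d : 0 < d -> \forall t \near at0, t < d.
Proof. by move=> d0; apply/at0P; exists d. Qed.

(** The convention that 0 to the power 0 is 1 lets the law survive at t = 0, a point that [at0] does
    not exclude. *)
Lemma powRD_ge0 (t r s : R) : 0 <= r -> 0 <= s ->
  t `^ (r + s) = t `^ r * t `^ s.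
Proof.
move=> r0 s0; have [->|tn0] := eqVneq t 0; last first.
  by apply: powRD; rewrite tn0 implybT.
have [->|rn0] := eqVneq r 0; first by rewrite add0r powRr0 mul1r.
rewrite (powR0 rn0) mul0r powR0//.
by rewrite gt_eqF// ltr_wpDr// lt_def rn0.
Qed.

Lemma at0_powR_le h e : 0 < h -> 0 < e -> \forall t \near at0, t `^ h <= e.
Proof.
move=> h0 e0; have k0 : 0 < e `^ h^-1 by apply: powR_gt0.
have := at0_lt k0; apply: filterS2 at0_ge0 => t t0 tk.
have -> : e = (e `^ h^-1) `^ h by rewrite -powRrM mulVf ?gt_eqF// powRr1// ltW.
by apply: ge0_ler_powR; rewrite ?nnegrE// ltW// (le_lt_trans t0).
Qed.

Lemma powR_le1 (t e : R) : 0 <= e -> 0 <= t -> t <= 1 -> t `^ e <= 1.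
Proof.
move=> e0 t0 t1; have -> : (1 : R) = 1 `^ e by rewrite powR1.
by apply: ge0_ler_powR; rewrite ?nnegrE// ler01.
Qed.

(** One neighbourhood of t = 0 serves all y in B. This uniformity permits the substitution y = x t
    in [uo_is_o] and mean value estimates in y. The exponent e = 1 gives o(t); smaller e are needed
    to compare powers of t with each other. *)
Definition uo B e w := forall eps, 0 < eps ->
  \forall t \near at0, forall y, B y -> `|w t y| <= eps * t `^ e.

Definition ubounded B H := exists M,
  \forall t \near at0, forall y, B y -> `|H t y| <= M.

Lemma uo_sub B B' e w : B' `<=` B -> uo B e w -> uo B' e w.
Proof.
move=> sB h eps /h; apply: filterS => t + y /sB; exact.
Qed.

Lemma uo_near B e w w' : (\forall t \near at0, forall y, B y -> w t y = w' t y) ->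
  uo B e w -> uo B e w'.
Proof.
move=> ww h eps /h; apply: filterS2 ww => t ww + y By.
by rewrite -ww//; exact.
Qed.

Lemma uo_eq B e w w' : (forall t y, 0 <= t -> B y -> w t y = w' t y) ->
  uo B e w -> uo B e w'.
Proof.
move=> ww; apply: uo_near; apply: filterS at0_ge0 => t t0 y By; exact: ww.
Qed.

Lemma uo0 B e : uo B e (fun _ _ => 0).
Proof.
move=> eps e0; apply: filterS at0_ge0 => t t0 y _.
by rewrite normr0 mulr_ge0 ?powR_ge0// ltW.
Qed.

Lemma uoD B e w w' : uo B e w -> uo B e w' -> uo B e (fun t y => w t y + w' t y).
Proof.
move=> h h' eps e0; have e2 : 0 < eps / 2 by rewrite divr_gt0.
apply: filterS2 (h _ e2) (h' _ e2) => t a b y By.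
rewrite (le_trans (ler_normD _ _))// [eps]splitr mulrDl lerD//.
  exact: a.
exact: b.
Qed.

Lemma uo_bounded B e w H : ubounded B H -> uo B e w ->
  uo B e (fun t y => w t y * H t y).
Proof.
move=> [M hM] h eps e0; have M1 : 0 < `|M| + 1 by rewrite ltr_wpDl.
have e1 : 0 < eps / (`|M| + 1) by rewrite divr_gt0.
apply: filterS3 at0_ge0 hM (h _ e1) => t t0 hM hw y By.
rewrite normrM (le_trans (ler_pM _ _ (hw _ By) (hM _ By)))//.
rewrite mulrAC; apply: ler_wpM2r; first exact: powR_ge0.
rewrite mulrAC ler_pdivrMr// ler_pM2l//.
by rewrite (le_trans (ler_norm _))// lerDl.
Qed.

Lemma uoZ B e (k : R) w : uo B e w -> uo B e (fun t y => w t y * k).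
Proof. by apply: uo_bounded; exists `|k|; apply: filterS at0_ge0. Qed.

Lemma uoN B e w : uo B e w -> uo B e (fun t y => - w t y).
Proof.
by move=> /(uoZ (-1)); apply: uo_eq => t y _ _; rewrite mulrN1.
Qed.

Lemma uoB B e w w' : uo B e w -> uo B e w' -> uo B e (fun t y => w t y - w' t y).
Proof. by move=> a b; apply: uoD => //; apply: uoN. Qed.

Lemma uo_sum (T : eqType) (s : seq T) B e (w : T -> R -> R -> R) :
  (forall i, i \in s -> uo B e (w i)) -> uo B e (fun t y => \sum_(i <- s) w i t y).
Proof.
elim: s => [|i s IH] h.
  by apply: uo_eq (uo0 B e) => t y _ _; rewrite big_nil.
have := uoD (h i (mem_head _ _)) (IH (fun j js => h j (mem_behead (s := i :: s) js))).
by apply: uo_eq => t y _ _; rewrite big_cons.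
Qed.

Lemma uo_powR B e b (c : R -> R) M : 0 <= e -> e < b ->
  (forall y, B y -> `|c y| <= M) -> uo B e (fun t y => c y * t `^ b).
Proof.
move=> e0 eb cM; suff h : uo B e (fun t _ => t `^ b).
  apply: (@uo_eq _ _ (fun t y => t `^ b * c y)); first by move=> *; rewrite mulrC.
  by apply: uo_bounded h; exists M; apply: filterS at0_ge0 => t _; exact: cM.
move=> eps eps0; have be : 0 < b - e by rewrite subr_gt0.
apply: filterS2 at0_ge0 (at0_powR_le be eps0) => t t0 te y _.
rewrite ger0_norm ?powR_ge0//.
have -> : b = (b - e) + e by rewrite subrK.
rewrite powRD_ge0//; last exact: ltW.
by apply: ler_wpM2r => //; exact: powR_ge0.
Qed.

Lemma is_o_uo B (w : R -> R) : is_o w -> uo B 1 (fun t _ => w t).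
Proof.
move=> h eps /h /at0P; apply: filterS2 at0_ge0 => t t0 + y _.
by rewrite powRr1.
Qed.

Lemma uo_is_o B (x : R -> R) w : (\forall t \near at0, B (x t)) ->
  uo B 1 w -> is_o (fun t => w t (x t)).
Proof.
move=> Bx h eps /h h'; apply/at0P; apply: filterS3 at0_ge0 Bx h' => t t0 Bx.
by move=> /(_ _ Bx); rewrite powRr1.
Qed.

(** Lets functions of t alone enter the [uo] calculus, with y as a dummy variable. *)
Lemma is_oE (w : R -> R) : is_o w <-> uo setT 1 (fun t _ => w t).
Proof.
split; first exact: is_o_uo.
by move=> h; apply: (@uo_is_o setT (fun=> 0) (fun t _ => w t)) => //; apply: filterE.
Qed.

End LittleO.

Arguments at0 R : clear implicits.

(** * Smooth functions of one real variable: derivative towers, Taylor bound, primitives *)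

Section Smooth1.
Local Open Scope classical_set_scope.
Variable R : realType.
Implicit Types (W B : set R) (c : R -> R).

Record smooth1 W c : Prop := Smooth1 {
  smooth1_derivable : forall k y, W y -> derivable c^`(k) y 1 }.

Lemma smooth1_is_derive W c k y : smooth1 W c -> W y ->
  is_derive y 1 c^`(k) (c^`(k.+1) y).
Proof. by move=> sc Wy; rewrite derive1nS derive1E; exact/derivableP/(smooth1_derivable sc). Qed.

Lemma open_near W (P : R -> Prop) y : open W -> W y ->
  (forall z, W z -> P z) -> \forall z \near y, P z.
Proof.
by move=> oW Wy WP; have := open_nbhs_nbhs (conj oW Wy); apply: filterS.
Qed.

(** The value of a derivative at y depends only on the function near y; as W is open, agreement with
    [F k] on all of W passes from each derivative to the next. *)
Lemma towerE W c (F : nat -> R -> R) : open W ->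
  (forall y, W y -> F 0%N y = c y) ->
  (forall k y, W y -> is_derive y 1 (F k) (F k.+1 y)) ->
  forall k y, W y -> c^`(k) y = F k y /\ derivable c^`(k) y 1.
Proof.
move=> oW F0 dF; elim=> [|k IH] y Wy.
  rewrite derive1n0; split; first by rewrite F0.
  apply: (@near_eq_derivable _ _ _ (F 0%N)); first exact: open_near F0.
  by case: (dF 0%N y Wy).
have E z : W z -> c^`(k.+1) z = F k.+1 z.
  move=> Wz; rewrite derive1nS derive1E.
  have -> : 'D_1 c^`(k) z = 'D_1 (F k) z.
    by apply: near_eq_derive; apply: open_near Wz _ => // x /IH[].
  by case: (dF k z Wz).
split; first exact: E.
apply: (@near_eq_derivable _ _ _ (F k.+1)).
  by apply: open_near Wy _ => // z Wz; rewrite E.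
by case: (dF k.+1 y Wy).
Qed.

Lemma tower_smooth1 W c (F : nat -> R -> R) : open W ->
  (forall y, W y -> F 0%N y = c y) ->
  (forall k y, W y -> is_derive y 1 (F k) (F k.+1 y)) -> smooth1 W c.
Proof. by move=> oW F0 dF; split=> k y Wy; have [] := towerE oW F0 dF k Wy. Qed.

Lemma derive1n_eq W c c' : open W -> (forall y, W y -> c y = c' y) ->
  forall k y, W y -> c^`(k) y = c'^`(k) y.
Proof.
move=> oW cc; elim=> [|k IH] y Wy; first by rewrite !derive1n0 cc.
rewrite !derive1nS !derive1E; apply: near_eq_derive.
exact: (open_near oW Wy).
Qed.

Lemma smooth1_eq W c c' : open W -> (forall y, W y -> c y = c' y) ->
  smooth1 W c -> smooth1 W c'.
Proof.
move=> oW cc [sc]; split=> k y Wy; apply: near_eq_derivable (sc k y Wy).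
by apply: (open_near oW Wy) => z; exact: derive1n_eq.
Qed.

Lemma smooth1_sub W W' c : W' `<=` W -> smooth1 W c -> smooth1 W' c.
Proof. by move=> sW [sc]; split=> k y /sW; exact: sc. Qed.

Lemma smooth1U W W' c : smooth1 W c -> smooth1 W' c -> smooth1 (W `|` W') c.
Proof. by move=> [sc] [sc']; split=> k y [/sc|/sc']. Qed.

Lemma smooth1_cst W (a : R) : open W -> smooth1 W (fun=> a).
Proof.
move=> oW; apply: (@tower_smooth1 _ _ (fun k _ => if k is 0%N then a else 0)) => //.
Qed.

Lemma smooth1D W c c' : open W -> smooth1 W c -> smooth1 W c' ->
  smooth1 W (fun y => c y + c' y).
Proof.
move=> oW sc sc'.
apply: (@tower_smooth1 _ _ (fun k => derive1n k c + derive1n k c')) => // k y Wy.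
by apply: is_deriveD; exact: smooth1_is_derive Wy.
Qed.

Lemma smooth1Z W (a : R) c : open W -> smooth1 W c -> smooth1 W (fun y => a * c y).
Proof.
move=> oW sc; apply: (@tower_smooth1 _ _ (fun k => a \*: derive1n k c)) => // k y Wy.
by apply: is_deriveZ; exact: smooth1_is_derive Wy.
Qed.

Lemma smooth1_primitive W c C : open W -> smooth1 W c ->
  (forall y, W y -> is_derive y 1 C (c y)) -> smooth1 W C.
Proof.
move=> oW sc dC.
apply: (@tower_smooth1 _ _ (fun k => if k is k'.+1 then c^`(k') else C)) => //.
by move=> [|k] y Wy; [exact: dC|exact: smooth1_is_derive Wy].
Qed.

Lemma smooth1_continuous W c k : smooth1 W c -> forall y, W y ->
  {for y, continuous c^`(k)}.
Proof.
move=> sc y Wy; apply: differentiable_continuous; apply/derivable1_diffP.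
exact: (smooth1_derivable sc).
Qed.

(* The remainder of order n at x0 differentiates to the remainder of order n.-1
   of the derivative, so the mean value theorem gives one factor per step. *)
Lemma taylor_bound n (F : nat -> R -> R) (x0 x M : R) :
  (forall k y, (k < n)%N -> `|y - x0| <= `|x - x0| ->
     is_derive y 1 (F k) (F k.+1 y)) ->
  (forall y, `|y - x0| <= `|x - x0| -> `|F n y| <= M) ->
  `|F 0%N x - \sum_(k < n) F k x0 / k`!%:R * (x - x0) ^+ k| <= M * `|x - x0| ^+ n.
Proof.
elim: n F x => [|n IH] F x dF hM.
  by rewrite big_ord0 subr0 expr0 mulr1 hM.
set r := fun y => F 0%N y - \sum_(k < n.+1) F k x0 / k`!%:R * (y - x0) ^+ k.
set r' := fun y => F 1%N y - \sum_(k < n) F k.+1 x0 / k`!%:R * (y - x0) ^+ k.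
have dr y : `|y - x0| <= `|x - x0| -> is_derive y 1 r (r' y).
  move=> yx.
  have -> : r = F 0%N - \sum_(k < n.+1) (F k x0 / k`!%:R) \*: (fun y => (y - x0) ^+ k).
    by apply/funext => z; rewrite /r fctE fct_sumE.
  have -> : r' y = F 1%N y - \sum_(k < n.+1) (F k x0 / k`!%:R) *:
      (k%:R * (y - x0) ^+ k.-1).
    rewrite /r' big_ord_recl /= mul0r scaler0 add0r; congr (_ - _).
    apply: eq_bigr => k _; rewrite /= /bump/= add1n /GRing.scale/=.
    rewrite factS natrM invfM (mulrC k.+1%:R^-1) [RHS]mulrA (mulrA (F _ _)).
    by rewrite mulfVK ?pnatr_eq0.
  apply: is_deriveB; first exact: dF.
  apply: is_derive_sum => k; apply: is_deriveZ.
  have -> : (fun y => (y - x0) ^+ k) = (fun y => y - x0) ^+ k.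
    by apply/funext => z; rewrite exprfctE.
  have d1 : is_derive y 1 (fun y => y - x0) 1 := is_derive_shift y 1 (- x0).
  have := is_deriveX k d1; move=> H; apply: is_derive_eq H _.
  by rewrite /GRing.scale/= mulr1.
have r'M y : `|y - x0| <= `|x - x0| -> `|r' y| <= M * `|x - x0| ^+ n.
  move=> yx; have M0 : 0 <= M by rewrite (le_trans (normr_ge0 (F n.+1 y)))// hM.
  apply: (@le_trans _ _ (M * `|y - x0| ^+ n)); last first.
    by rewrite ler_wpM2l// lerXn2r ?nnegrE.
  apply: (IH (fun k => F k.+1)) => [k z kn zy|z zy].
    by apply: dF => //; exact: le_trans yx.
  by apply: hM; exact: le_trans yx.
have r0 : r x0 = 0.
  rewrite /r big_ord_recl/= fact0 divr1 subrr expr0 mulr1 big1 ?addr0 ?subrr//.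
  by move=> i _; rewrite /= expr0n/= mulr0.
rewrite -/(r x) exprSr mulrA.
have btw (p q z : R) : (p = x0 /\ q = x) \/ (p = x /\ q = x0) -> p <= z <= q -> `|z - x0| <= `|x - x0|.
  move=> [][-> ->] /andP[a b].
    by rewrite !ger0_norm ?subr_ge0 ?lerD2r// (le_trans a).
  by rewrite !ler0_norm ?subr_le0 ?lerN2 ?lerD2r// (le_trans a).
have cont p q : (p = x0 /\ q = x) \/ (p = x /\ q = x0) -> {within `[p, q], continuous r}.
  move=> pq; apply: derivable_within_continuous => z; rewrite in_itv/= => zpq.
  by case: (dr z (btw _ _ _ pq zpq)).
have [xx|xx] := leP x0 x.
  have pq : (x0 = x0 /\ x = x) \/ (x0 = x /\ x = x0) by left.
  have [|z] := MVT_segment (f := r) (df := r') xx _ (cont _ _ pq).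
    move=> z; rewrite in_itv/= => /andP[/ltW a /ltW b]; apply: dr.
    by apply: (btw _ _ _ pq); rewrite a b.
  rewrite in_itv/= r0 subr0 => zxx ->; rewrite normrM ler_wpM2r// r'M//.
  exact: btw pq zxx.
have pq : (x = x0 /\ x0 = x) \/ (x = x /\ x0 = x0) by right.
have [|z] := MVT_segment (f := r) (df := r') (ltW xx) _ (cont _ _ pq).
  move=> z; rewrite in_itv/= => /andP[/ltW a /ltW b]; apply: dr.
  by apply: (btw _ _ _ pq); rewrite a b.
rewrite in_itv/= r0 sub0r => zxx /(congr1 Num.norm); rewrite normrN => ->.
rewrite normrM (distrC x0 x) ler_wpM2r// r'M//.
exact: btw pq zxx.
Qed.

Lemma derive_bound (h h' : R -> R) (x0 x M : R) :
  (forall y, `|y - x0| <= `|x - x0| -> is_derive y 1 h (h' y)) ->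
  (forall y, `|y - x0| <= `|x - x0| -> `|h' y| <= M) ->
  `|h x - h x0| <= M * `|x - x0|.
Proof.
move=> dh hM.
have := @taylor_bound 1 (fun k => if k is 0%N then h else h') x0 x M.
rewrite big_ord1 fact0 divr1 expr0 mulr1 expr1; apply => //.
by case=> // y _; exact: dh.
Qed.

(** On the open interval c may fail to be integrable up to l or r. On the compact segment from l' to
    r' it is continuous, hence integrable, and the fundamental theorem applies inside. *)
Lemma continuous_primitive (c : R -> R) (l r : R) :
  (forall y, l < y < r -> {for y, continuous c}) ->
  forall l' r', l < l' -> r' < r ->
  exists C, forall y, l' < y < r' -> is_derive y 1 C (c y).
Proof.
move=> cc l' r' ll rr.
exists (fun x => (\int[lebesgue_measure]_(t in `[l', x]) (c t))%R) => y /andP[ly yr].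
have [] := @continuous_FTC1_closed R c l' y r' yr _ ly (cc y _).
- apply: continuous_compact_integrable; first exact: segment_compact.
  apply: continuous_in_subspaceT => z; rewrite inE/= in_itv/= => /andP[a b].
  by apply: cc; rewrite (lt_le_trans ll)//= (le_lt_trans b).
- by rewrite (lt_trans ll)//= (lt_trans yr).
by move=> d <-; rewrite derive1E; exact: derivableP.
Qed.

End Smooth1.

(** * Hölder bounds for Fermat reals, and expansions in powers of t with smooth coefficients *)

Section Expansion.
Variable R : realType.
Implicit Types (B : set R) (bs : seq R) (c : R -> R -> R) (w H : R -> R -> R).

(** The modulus of continuity at 0 of a Fermat real: the least positive exponent occurring in it, or
    1 from its o(t) part, can be taken for a. *)
Definition holder0 (x : R -> R) := exists a K, 0 < a /\
  \forall t \near at0 R, `|x t - x 0| <= K * t `^ a.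

Lemma holder0_cst (k : R) : holder0 (fun=> k).
Proof.
by exists 1, 0; split=> //; apply: filterE => t; rewrite subrr normr0 mul0r.
Qed.

Lemma holder0D (x x' : R -> R) :
  holder0 x -> holder0 x' -> holder0 (fun t => x t + x' t).
Proof.
move=> [a [K [a0 h]]] [a' [K' [a'0 h']]].
exists (Num.min a a'), (`|K| + `|K'|); split; first by rewrite lt_min a0.
have h01 : \forall t \near at0 R, 0 <= t /\ t < 1.
  by have := at0_lt (@ltr01 R); apply: filterS2 (at0_ge0 R).
apply: filterS3 h01 h h' => t [t0 /ltW t1] k k'.
have le (u v : R) : 0 < u -> u <= v -> t `^ v <= t `^ u.
  move=> u0 uv; have [->|tn0] := eqVneq t 0.
    by rewrite !powR0 ?gt_eqF// (lt_le_trans u0).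
  by apply: ger_powR => //; rewrite lt_def tn0 t0.
have m0 : 0 < Num.min a a' by rewrite lt_min a0.
rewrite opprD addrACA (le_trans (ler_normD _ _))// mulrDl lerD//.
  rewrite (le_trans k)// (le_trans (ler_wpM2r (powR_ge0 _ _) (ler_norm _)))//.
  by apply: ler_wpM2l => //; apply: le; rewrite ?ge_min ?lexx.
rewrite (le_trans k')// (le_trans (ler_wpM2r (powR_ge0 _ _) (ler_norm _)))//.
by apply: ler_wpM2l => //; apply: le; rewrite ?ge_min ?lexx ?orbT.
Qed.

Lemma holder0_powR (k b : R) : 0 <= b -> holder0 (fun t => k * t `^ b).
Proof.
rewrite le_eqVlt => /predU1P[<-|b0].
  by have := holder0_cst k; congr holder0; apply/funext => t; rewrite powRr0 mulr1.
exists b, `|k|; split=> //; apply: filterE => t.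
by rewrite (@powR0 _ b) ?gt_eqF// mulr0 subr0 normrM (ger0_norm (powR_ge0 _ _)).
Qed.

Lemma is_o_at0 (w : R -> R) : is_o w -> w 0 = 0.
Proof.
move=> /(_ _ ltr01)[d d0 /(_ 0 (lexx _) d0)]; rewrite mulr0 normr_le0.
by move/eqP.
Qed.

Lemma holder0_is_o (w : R -> R) : is_o w -> holder0 w.
Proof.
move=> wo; exists 1, 1; split=> //; have /at0P := wo _ ltr01.
apply: filterS2 (at0_ge0 R) => t t0.
by rewrite (is_o_at0 wo) subr0 powRr1.
Qed.

Lemma fermat_holder0 (x : R -> R) : fermat x -> holder0 x.
Proof.
move=> [r [k [al [aa [aa0 xo]]]]].
pose p := fun t => r + \sum_(1 <= i < k.+1) al i * t `^ aa i.
have -> : x = fun t => p t + (x t - p t) by apply/funext => t; rewrite addrC subrK.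
apply: holder0D; last exact: holder0_is_o.
apply: holder0D; first exact: holder0_cst.
elim: k {xo p} => [|k IH].
  have := holder0_cst 0; congr holder0; apply/funext => t.
  by rewrite big_geq.
have := holder0D IH (holder0_powR (al k.+1) (aa0 k.+1)); congr holder0.
by apply/funext => t; rewrite [RHS]big_nat_recr.
Qed.

Lemma fermat_near (x : R -> R) e : fermat x -> 0 < e ->
  \forall t \near at0 R, `|x t - x 0| < e.
Proof.
move=> /fermat_holder0[a [K [a0 h]]] e0.
have e1 : 0 < (e / 2) / (`|K| + 1) by rewrite !divr_gt0// ltr_wpDl.
apply: filterS3 h (at0_powR_le a0 e1) (at0_ge0 R) => t h t1 t0.
rewrite (le_lt_trans h)// (le_lt_trans (ler_wpM2r (powR_ge0 _ _) (ler_norm _)))//.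
rewrite (@le_lt_trans _ _ (e / 2))//; last first.
  by rewrite ltr_pdivrMr// ltr_pMr// ltr1n.
rewrite (@le_trans _ _ ((`|K| + 1) * t `^ a))//.
  by rewrite ler_wpM2r ?powR_ge0// lerDl.
by rewrite mulrC -ler_pdivlMr// ltr_wpDl.
Qed.

(** Nilpotency of infinitesimals. The order N does not depend on M, so the bound on a Taylor
    remainder may be chosen after N. *)
Lemma fermat_pow_o (x : R -> R) : fermat x ->
  exists N, forall M, is_o (fun t => M * `|x t - x 0| ^+ N).
Proof.
move=> /fermat_holder0[a [K [a0 h]]].
(* This N exceeds 1 / a, so the N-th power of the Hölder bound has exponent a N > 1. *)
exists (Num.truncn a^-1).+1 => M; apply/is_oE; set N := _.+1.
have aN : 1 < a * N%:R.
  by rewrite mulrC -ltr_pdivrMr// div1r truncnS_gt.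
have := @uo_powR R setT 1 (a * N%:R) (fun=> M * `|K| ^+ N) `|M * `|K| ^+ N| ler01 aN.
move=> /(_ (fun _ _ => lexx _)) u eps /u.
apply: filterS3 (at0_ge0 R) h => t t0 h + y _ => /(_ y I); apply: le_trans.
rewrite !normrM -mulrA; apply: ler_wpM2l => //.
rewrite !normrX !normr_id powRrM powR_mulrn ?powR_ge0//.
rewrite (ger0_norm (exprn_ge0 _ (powR_ge0 _ _))) -exprMn.
apply: lerXn2r; rewrite ?nnegrE ?mulr_ge0 ?powR_ge0//.
by rewrite (le_trans h)// ler_wpM2r ?powR_ge0// ler_norm.
Qed.

Definition nf bs c t y := \sum_(b <- bs) c b y * t `^ b.

(* c is indexed by the exponents themselves and vanishes off bs: the list can be
   enlarged freely, and adding expansions just adds coefficient functions. *)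
Definition coefs B bs c := [/\ uniq bs, {in bs, forall b, 0 <= b},
  forall b y, b \notin bs -> c b y = 0 & forall b, smooth1 B (c b)].

(** A coefficient that is smooth on an open set may blow up at its boundary; the bound is what makes
    its terms with exponent above 1 uniformly o(t), and products with o(t) again o(t). *)
Definition cbounded B c := forall b, exists M, forall y, B y -> `|c b y| <= M.

Definition expands B H :=
  exists bs c, [/\ coefs B bs c, cbounded B c & uo B 1 (fun t y => H t y - nf bs c t y)].

Lemma nf_subset bs bs' c t y : uniq bs -> uniq bs' -> {subset bs <= bs'} ->
  (forall b y, b \notin bs -> c b y = 0) -> nf bs' c t y = nf bs c t y.
Proof.
move=> u u' sub off; rewrite /nf (bigID (mem bs)) /= [X in _ + X]big1; last first.
  by move=> b bn; rewrite off// mul0r.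
rewrite addr0 -big_filter; apply: perm_big; apply: uniq_perm => //.
  exact: filter_uniq.
by move=> b; rewrite mem_filter andb_idr// => /sub.
Qed.

Lemma coefs_merge B bs bs' c c' : open B -> coefs B bs c -> coefs B bs' c' ->
  let U := undup (bs ++ bs') in
  [/\ coefs B U (fun b y => c b y + c' b y),
    forall t y, nf U c t y = nf bs c t y & forall t y, nf U c' t y = nf bs' c' t y].
Proof.
move=> oB [u p off s] [u' p' off' s'] U; have uU : uniq U by exact: undup_uniq.
have bU : {subset bs <= U} by move=> b; rewrite mem_undup mem_cat => ->.
have bU' : {subset bs' <= U} by move=> b; rewrite mem_undup mem_cat orbC => ->.
split; [split=> //|by move=> t y; exact: nf_subset|by move=> t y; exact: nf_subset].
- by move=> b; rewrite mem_undup mem_cat => /orP[/p|/p'].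
- move=> b y; rewrite mem_undup mem_cat negb_or => /andP[/off -> /off' ->].
  by rewrite addr0.
- by move=> b; exact: smooth1D.
Qed.

Lemma expands_near B H H' : (\forall t \near at0 R, forall y, B y -> H t y = H' t y) ->
  expands B H -> expands B H'.
Proof.
move=> HH [bs [c [cf cb u]]]; exists bs, c; split=> //; apply: uo_near u.
by apply: filterS HH => t h y By; rewrite h.
Qed.

Lemma expands_eq B H H' : (forall t y, H t y = H' t y) ->
  expands B H -> expands B H'.
Proof. by move=> HH; apply: expands_near; apply: filterE => t y _. Qed.

Lemma expands_sub B B' H : B' `<=` B -> expands B H -> expands B' H.
Proof.
move=> sB [bs [c [[u p off s] cb uH]]]; exists bs, c; split.
- by split=> // b; exact: smooth1_sub (s b).
- by move=> b; have [M hM] := cb b; exists M => y /sB; exact: hM.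
- exact: uo_sub uH.
Qed.

Lemma expands_uo B w : open B -> uo B 1 w -> expands B w.
Proof.
move=> oB u; exists [::], (fun _ _ => 0); split.
- by split=> // b; exact: smooth1_cst.
- by move=> b; exists 0 => y _; rewrite normr0.
- by apply: uo_eq u => t y _ _; rewrite /nf big_nil subr0.
Qed.

Lemma expands_fun B (g : R -> R) M : open B -> smooth1 B g ->
  (forall y, B y -> `|g y| <= M) -> expands B (fun _ y => g y).
Proof.
move=> oB sg gM; exists [:: 0], (fun b => if b == 0 then g else fun=> 0); split.
- split=> //.
  + by move=> b; rewrite inE => /eqP ->.
  + by move=> b y; rewrite inE => /negbTE ->.
  + by move=> b; case: ifP => // _; exact: smooth1_cst.
- move=> b; case: ifP => _; first by exists M.
  by exists 0 => y _; rewrite normr0.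
- apply: uo_eq (uo0 _ _) => t y _ _.
  by rewrite /nf big_seq1 eqxx powRr0 mulr1 subrr.
Qed.

Lemma expands_cst B (k : R) : open B -> expands B (fun _ _ => k).
Proof. by move=> oB; apply: (@expands_fun _ (fun=> k) `|k|) => //; exact: smooth1_cst. Qed.

Lemma expandsD B H H' : open B -> expands B H -> expands B H' ->
  expands B (fun t y => H t y + H' t y).
Proof.
move=> oB [bs [c [cf cb u]]] [bs' [c' [cf' cb' u']]].
have [cU nU nU'] := coefs_merge oB cf cf'.
exists (undup (bs ++ bs')), (fun b y => c b y + c' b y); split=> //.
  move=> b; have [M hM] := cb b; have [M' hM'] := cb' b; exists (M + M') => y By.
  by rewrite (le_trans (ler_normD _ _))// lerD ?hM ?hM'.
apply: uo_eq (uoD u u') => t y _ _; rewrite -nU -nU' addrACA -opprD; congr (_ - _).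
by rewrite /nf -big_split; apply: eq_bigr => b _; rewrite mulrDl.
Qed.

(** All exponents move up by a. As coefficients are indexed by the exponents themselves, the new one
    at b is the old one at b - a. *)
Lemma expands_powR B H a : 0 <= a -> expands B H ->
  expands B (fun t y => t `^ a * H t y).
Proof.
move=> a0 [bs [c [[u p off s] cb uH]]].
exists (map (+%R a) bs), (fun b => c (b - a)); split.
- split=> //.
  + by rewrite map_inj_uniq//; exact: addrI.
  + by move=> _ /mapP[b /p b0 ->]; rewrite addr_ge0.
  + move=> b y bn; apply: off; apply: contra bn => bb; apply/mapP; exists (b - a) => //.
    by rewrite addrC subrK.
- by move=> b.
- have tb : ubounded B (fun t _ => t `^ a).
    exists 1; apply: filterS2 (at0_ge0 R) (at0_lt ltr01) => t t0 /ltW t1 y _.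
    by rewrite ger0_norm ?powR_ge0// powR_le1.
  apply: uo_eq (uo_bounded tb uH) => t y _ _.
  rewrite mulrC mulrBr; congr (_ - _); rewrite /nf big_map mulr_sumr.
  rewrite big_seq [RHS]big_seq; apply: eq_bigr => b /p b0.
  by rewrite addrAC subrr add0r powRD_ge0// mulrCA.
Qed.

Lemma expandsZ B H (k : R) : open B -> expands B H -> expands B (fun t y => k * H t y).
Proof.
move=> oB [bs [c [[u p off s] cb uH]]]; exists bs, (fun b y => k * c b y); split.
- split=> //.
  + by move=> b y /off ->; rewrite mulr0.
  + by move=> b; exact: smooth1Z.
- move=> b; have [M hM] := cb b; exists (`|k| * M) => y By.
  by rewrite normrM ler_wpM2l// hM.
- apply: uo_eq (uoZ k uH) => t y _ _; rewrite mulrC mulrBr; congr (_ - _).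
  by rewrite /nf mulr_sumr; apply: eq_bigr => b _; rewrite mulrA.
Qed.

Lemma expandsN B H : open B -> expands B H -> expands B (fun t y => - H t y).
Proof.
by move=> oB /(expandsZ (-1) oB); apply: expands_eq => t y; rewrite mulN1r.
Qed.

Lemma expands_sum (T : eqType) (s : seq T) B (h : T -> R -> R -> R) : open B ->
  (forall i, i \in s -> expands B (h i)) ->
  expands B (fun t y => \sum_(i <- s) h i t y).
Proof.
move=> oB; elim: s => [|i s IH] e.
  by apply: expands_eq (expands_cst 0 oB) => t y; rewrite big_nil.
have IH' := IH (fun j js => e j (mem_behead (s := i :: s) js)).
by apply: expands_eq (expandsD oB (e i (mem_head _ _)) IH') => t y; rewrite big_cons.
Qed.

Lemma nf_bounded B bs c : coefs B bs c -> cbounded B c -> ubounded B (nf bs c).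
Proof.
move=> [_ p _ _] cb; rewrite /nf; elim: bs p => [|b bs IH] p.
  by exists 0; apply: filterE => t y _; rewrite big_nil normr0.
have [M hM] := IH (fun b' bb => p b' (mem_behead (s := b :: bs) bb)).
have [N hN] := cb b; exists (N + M).
apply: filterS3 (at0_ge0 R) (at0_lt ltr01) hM => t t0 /ltW t1 hM y By.
rewrite big_cons (le_trans (ler_normD _ _))// lerD ?hM// normrM.
rewrite (ger0_norm (powR_ge0 _ _)) -[N]mulr1 ler_pM ?powR_ge0 ?hN//.
by rewrite powR_le1// p// mem_head.
Qed.

Lemma uo1_bounded B w : uo B 1 w -> ubounded B w.
Proof.
move=> /(_ _ ltr01) u; exists 1.
apply: filterS3 (at0_ge0 R) (at0_lt ltr01) u => t t0 /ltW t1 u y By.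
by rewrite (le_trans (u _ By))// mul1r powRr1.
Qed.

Lemma expands_bounded B H : expands B H -> ubounded B H.
Proof.
move=> [bs [c [cf cb /uo1_bounded[M hM]]]]; have [N hN] := nf_bounded cf cb.
exists (M + N); apply: filterS2 hM hN => t hM hN y By.
by rewrite -[H t y](subrK (nf bs c t y)) (le_trans (ler_normD _ _))// lerD ?hM ?hN.
Qed.

(** The o(t) part of x is absorbed because H is bounded for small t; each power in x shifts the
    exponents of H. *)
Lemma expands_fermat B H x : open B -> fermat x -> expands B H ->
  expands B (fun t y => x t * H t y).
Proof.
move=> oB [r [k [al [aa [aa0 xo]]]]] eH.
pose p t := r + \sum_(1 <= i < k.+1) al i * t `^ aa i.
have eo : expands B (fun t y => (x t - p t) * H t y).
  apply: expands_uo => //; apply: uo_bounded; first exact: expands_bounded.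
  exact: is_o_uo xo.
have ep : expands B (fun t y => p t * H t y).
  have e1 i : expands B (fun t y => al i * (t `^ aa i * H t y)).
    by apply: expandsZ => //; exact: expands_powR.
  have := expandsD oB (expandsZ r oB eH) (expands_sum (s := index_iota 1 k.+1) oB (fun i _ => e1 i)).
  apply: expands_eq => t y; rewrite /p mulrDl mulr_suml; congr (_ + _).
  by apply: eq_bigr => i _; rewrite mulrA.
by apply: expands_eq (expandsD oB eo ep) => t y; rewrite -mulrDl subrK.
Qed.

Lemma fermat_sub0 (x : R -> R) : fermat x -> fermat (fun t => x t - x 0).
Proof.
move=> [r [k [al [aa [aa0 xo]]]]]; exists (r - x 0), k, al, aa; split=> //.
move: xo; congr is_o; apply/funext => t.
by rewrite (addrAC r (- x 0)) opprB addrA subrK.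
Qed.

Lemma expands_fermatX B H x n : open B -> fermat x -> expands B H ->
  expands B (fun t y => (x t - x 0) ^+ n * H t y).
Proof.
move=> oB /fermat_sub0 fx0 eH; elim: n => [|n IH].
  by apply: expands_eq eH => t y; rewrite mul1r.
by apply: expands_eq (expands_fermat oB fx0 IH) => t y; rewrite exprS mulrA.
Qed.

Lemma expands_is_fermat B x y : B y -> expands B (fun t _ => x t) -> fermat x.
Proof.
move=> By [bs [c [[_ p _ _] _ u]]].
(* Sums in [fermat] start at index 1, whence [i.-1]; past the end of the list the default 0 keeps
   the exponents nonnegative. The real part is 0 because a constant term is already covered by the
   exponent 0. *)
exists 0, (size bs), (fun i => c (nth 0 bs i.-1) y), (fun i => nth 0 bs i.-1).
split=> [i|].
  have [/(mem_nth 0)/p//|h] := ltnP i.-1 (size bs); by rewrite nth_default.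
have h : is_o (fun t => x t - nf bs c t y).
  apply: (@uo_is_o _ B (fun=> y) _ _ u); exact: filterE.
move: h; congr is_o; apply/funext => t; rewrite add0r /nf (big_nth 0).
by rewrite [in RHS]big_add1.
Qed.

End Expansion.

(** * Taylor sums along a Fermat real, and independence of the powers of t up to o(t) *)

Section Taylor.
Variable R : realType.
Implicit Types (B W : set R) (H w : R -> R -> R).

(** The remainder is at most a constant times the N-th power of |x t - x 0|, which is o(t) for the N
    of [fermat_pow_o]. The constant exists since the N-th derivative stays within 1 of its value at
    [x 0] nearby. *)
Lemma smooth1_taylor_o W (C x : R -> R) : open W -> smooth1 W C -> fermat x ->
  W (x 0) -> exists N, is_o (fun t =>
    C (x t) - \sum_(k < N) derive1n k C (x 0) / k`!%:R * (x t - x 0) ^+ k).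
Proof.
move=> oW sC fx Wx; have [N hN] := fermat_pow_o fx; exists N.
have [r r0 rW] : exists2 r, 0 < r & ball (x 0) r `<=` W.
  by have := open_nbhs_nbhs (conj oW Wx) => /nbhs_ballP[r r0 rW]; exists r.
have := smooth1_continuous (k := N) sC Wx.
move=> /cvgrPdist_lt /(_ 1 ltr01) /nbhs_ballP[d d0 hd].
set M := `|derive1n N C (x 0)| + 1.
have m0 : 0 < Num.min r d by rewrite lt_min r0.
have bm y : `|y - x 0| < Num.min r d -> W y /\ `|derive1n N C y| <= M.
  rewrite lt_min distrC => /andP[yr yd]; split; first exact: rW.
  have := hd _ yd => /= h; have -> : derive1n N C y = derive1n N C (x 0) - (derive1n N C (x 0) - derive1n N C y) by ring.
  by rewrite (le_trans (ler_normB _ _))// lerD// ltW.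
apply/is_oE => eps eps0; have /is_oE/(_ _ eps0) h := hN M.
apply: filterS2 h (fermat_near fx m0) => t h xt y _.
apply: le_trans (h y I); apply: le_trans (ler_norm _).
apply: (@taylor_bound R N (fun k => derive1n k C) (x 0) (x t) M).
  move=> k z kN zx; apply: smooth1_is_derive sC _.
  by case: (bm z (le_lt_trans zx xt)).
by move=> z zx; case: (bm z (le_lt_trans zx xt)).
Qed.

Lemma expands_comp B W (C x : R -> R) : open B -> open W -> smooth1 W C ->
  fermat x -> W (x 0) -> expands B (fun t _ => C (x t)).
Proof.
move=> oB oW sC fx Wx; have [N oN] := smooth1_taylor_o oW sC fx Wx.
have e1 := expands_uo oB (is_o_uo B oN).
have e2 : expands B (fun t _ =>
    \sum_(k < N) derive1n k C (x 0) / k`!%:R * (x t - x 0) ^+ k).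
  apply: expands_sum => // k _; apply: expandsZ => //.
  by apply: expands_eq (expands_fermatX k oB fx (expands_cst 1 oB)) => t y; rewrite mulr1.
by apply: expands_eq (expandsD oB e1 e2) => t y; rewrite subrK.
Qed.

Lemma smooth1_flat_o W (C x : R -> R) : open W -> smooth1 W C -> fermat x ->
  W (x 0) -> (forall k, derive1n k C (x 0) = 0) -> is_o (fun t => C (x t)).
Proof.
move=> oW sC fx Wx C0; have [N] := smooth1_taylor_o oW sC fx Wx.
congr is_o; apply/funext => t; rewrite big1 ?subr0// => k _.
by rewrite C0 !mul0r.
Qed.

(** Both difference quotients are the same function of h; directional derivatives on row vectors
    thus reduce to one real variable. *)
Lemma derive_line (V : normedModType R) (G : V -> R) (z v : V) (s d : R) :
  is_derive s 1 (fun s => G (z + s *: v)) d <-> is_derive (z + s *: v) v G d.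
Proof.
have E : (fun h : R => h^-1 *: (((fun s => G (z + s *: v)) \o shift s) (h *: 1) - G (z + s *: v)))
       = (fun h : R => h^-1 *: ((G \o shift (z + s *: v)) (h *: v) - G (z + s *: v))).
  apply/funext => h /=; congr (_ *: (G _ - _)).
  by rewrite [h *: 1]mulr1 scalerDl addrCA.
split=> -[a b]; apply: DeriveDef.
- by move: a; rewrite /derivable E.
- by move: b; rewrite /derive E.
- by rewrite /derivable E.
- by rewrite /derive E.
Qed.

(* The least exponent with a nonzero coefficient would dominate the sum. *)
Lemma powR_sum_o_eq0 (bs : seq R) (k : R -> R) : uniq bs ->
  {in bs, forall b, 0 <= b <= 1} ->
  is_o (fun t => \sum_(b <- bs) k b * t `^ b) -> {in bs, forall b, k b = 0}.
Proof.
move=> u b01 o.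
suff: {in sort <=%R bs, forall b, k b = 0} by move=> h b; rewrite -(mem_sort <=%R); exact: h.
have us : uniq (sort <=%R bs) by rewrite sort_uniq.
have s : sorted <%R (sort <=%R bs) by rewrite lt_sorted_uniq_le us sort_sorted//; exact: le_total.
have s01 : {in sort <=%R bs, forall b, 0 <= b <= 1} by move=> b; rewrite mem_sort; exact: b01.
have {o} : is_o (fun t => \sum_(b <- sort <=%R bs) k b * t `^ b).
  move: o; congr is_o; apply/funext => t; apply: perm_big.
  by rewrite perm_sym perm_sort.
move: (sort _ _) s s01 => {us u b01} {}bs.
elim: bs => [//|b bs IH] s s01 o.
have /andP[b0 b1] := s01 b (mem_head _ _).
have /allP lb : all (> b) bs by apply: order_path_min s => x y z; exact: lt_trans.
have kb : k b = 0.
  (* The cap on exponents enters here: o(t) implies o(t^b) only because b <= 1. *)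
  have u1 : uo setT b (fun t _ => \sum_(b <- b :: bs) k b * t `^ b).
    move=> eps eps0; have /is_oE/(_ _ eps0) := o.
    apply: filterS3 (at0_ge0 R) (at0_lt ltr01) => t t0 /ltW t1 h y _.
    apply: (le_trans (h y I)); apply: (ler_wpM2l (ltW eps0)).
    have [->|tn0] := eqVneq t 0; first by rewrite (@powR0 _ 1) ?oner_neq0 ?powR_ge0.
    by apply: ger_powR => //; rewrite lt_def tn0 t0 t1.
  have u2 : uo setT b (fun t _ => \sum_(b' <- bs) k b' * t `^ b').
    apply: (@uo_sum _ _ bs setT b (fun b' t _ => k b' * t `^ b')) => b' /lb bb'.
    exact: (@uo_powR _ _ _ _ (fun=> k b') `|k b'|).
  (* Only the leading term is left, and it is o(t^b). With tolerance |k b| / 2, evaluated at one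
     positive t and divided by t^b, this reads |k b| <= |k b| / 2. *)
  have u3 := uoB u1 u2; apply/eqP; apply/negPn/negP => kn0.
  have k2 : 0 < `|k b| / 2 by rewrite divr_gt0// normr_gt0.
  have /at0P[d d0 hd] := u3 _ k2.
  have := hd (d / 2) _ _ 0 I; rewrite big_cons addrK normrM.
  have tb : 0 < (d / 2) `^ b by apply: powR_gt0; rewrite divr_gt0.
  rewrite (gtr0_norm tb) ler_pM2r// => /(_ _ _)/=.
  rewrite ltW ?divr_gt0// ltr_pdivrMr// ltr_pMr// ltr1n => /(_ isT isT).
  by rewrite ler_pdivlMr// ger_pMr ?normr_gt0// lern1.
move=> b'; rewrite inE => /predU1P[->//|b'bs].
apply: IH b'bs; [exact: path_sorted s| |].
  by move=> x xbs; apply: s01; rewrite inE xbs orbT.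
by move: o; congr is_o; apply/funext => t; rewrite big_cons kb mul0r add0r.
Qed.

End Taylor.

(** * Expansion of a parametrised smooth map along a Fermat parameter *)

Section LocalExpansion.
Variable R : realType.
Implicit Types (B W : set R) (H w : R -> R -> R).

Definition expands_at (x0 : R) H := exists2 d, 0 < d & expands (ball x0 d) H.

Lemma expands_at_eq x0 H H' : (forall t y, H t y = H' t y) ->
  expands_at x0 H -> expands_at x0 H'.
Proof. by move=> HH [d d0 e]; exists d => //; exact: expands_eq e. Qed.

Lemma expands_atD x0 H H' : expands_at x0 H -> expands_at x0 H' ->
  expands_at x0 (fun t y => H t y + H' t y).
Proof.
move=> [d d0 e] [d' d'0 e']; exists (Num.min d d'); first by rewrite lt_min d0.
apply: expandsD; first exact: ball_open.
  by apply: expands_sub e; apply: le_ball; rewrite ge_min lexx.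
by apply: expands_sub e'; apply: le_ball; rewrite ge_min lexx orbT.
Qed.

Lemma expands_at_sum (T : Type) (s : seq T) x0 (h : T -> R -> R -> R) :
  (forall i, expands_at x0 (h i)) ->
  expands_at x0 (fun t y => \sum_(i <- s) h i t y).
Proof.
move=> e; elim: s => [|i s IH].
  exists 1 => //; apply: expands_eq (expands_cst 0 (ball_open x0 1)) => t y.
  by rewrite big_nil.
by apply: expands_at_eq (expands_atD (e i) IH) => t y; rewrite big_cons.
Qed.

Lemma continuous_box n (z0 : 'rV[R]_n) (G : 'rV[R]_n -> R) :
  {for z0, continuous G} -> exists2 r, 0 < r &
    forall z : 'rV[R]_n, (forall i, `|z 0 i - z0 0 i| < r) -> `|G z| <= `|G z0| + 1.
Proof.
move=> /cvgrPdist_lt /(_ 1 ltr01) /nbhs_ballP[r r0 hr]; exists r => // z zr.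
have h : `|G z0 - G z| < 1.
  by apply: hr; split=> // i j; rewrite /ball/= (ord1 i) distrC.
have -> : G z = G z0 - (G z0 - G z) by ring.
by rewrite (le_trans (ler_normB _ _))// lerD// ltW.
Qed.

Lemma row_lineE n (z : 'rV[R]_n) (a : R) i j :
  (z + a *: delta_mx 0 i) 0 j = z 0 j + a * (j == i)%:R.
Proof. by rewrite mxE [X in _ + X]mxE [X in _ + _ * X]mxE. Qed.

Section Coordinates.
Variables (p : nat) (U : set 'rV[R]_(p + 1)) (g : 'rV[R]_(p + 1) -> R).
Variables (q : R -> 'rV[R]_p) (x0 r0 : R).
Let z0 : 'rV[R]_(p + 1) := row_mx (q 0) (const_mx x0).
Hypothesis r0_gt0 : 0 < r0.
Hypothesis boxU : forall z : 'rV[R]_(p + 1), (forall i, `|z 0 i - z0 0 i| < r0) -> U z.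
Hypothesis sg : smooth_on U g.
Hypothesis fq : fermat_vec q.

Let last := rshift p (@ord0 0).

Definition partial_row (s : seq 'I_p) t y : 'rV[R]_(p + 1) :=
  row_mx (\row_j (if j \in s then q t 0 j else q 0 0 j)) (const_mx y).

Lemma partial_rowEl s t y j :
  partial_row s t y 0 (lshift 1 j) = if j \in s then q t 0 j else q 0 0 j.
Proof. by rewrite /partial_row row_mxEl mxE. Qed.

Lemma partial_rowEr s t y : partial_row s t y 0 last = y.
Proof. by rewrite /partial_row row_mxEr mxE. Qed.

(** Repeated derivatives in one direction, prepended to l, form a tower along a line, which is the
    input of [tower_smooth1] and [taylor_bound]. They are always outermost, so no exchange of
    partial derivatives occurs. *)
Lemma ipartial_line l i k (z v : 'rV[R]_(p + 1)) (s : R) : U (z + s *: delta_mx 0 i) ->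
  v = delta_mx 0 i ->
  is_derive s 1 (fun s => ipartial (nseq k i ++ l) g (z + s *: v))
    (ipartial (nseq k.+1 i ++ l) g (z + s *: v)).
Proof.
move=> Uz ->; apply/derive_line => /=; apply: derivableP.
by have [_ +] := sg (nseq k i ++ l) Uz; apply.
Qed.

Lemma boxE (z : 'rV[R]_(p + 1)) (r : R) : (forall i, `|z 0 (lshift 1 i) - q 0 0 i| < r) ->
  `|z 0 last - x0| < r -> forall i, `|z 0 i - z0 0 i| < r.
Proof.
move=> h1 h2 i; rewrite -(splitK i); case: (fintype.split i) => j /=.
  by rewrite row_mxEl; exact: h1.
by rewrite row_mxEr mxE (ord1 j); exact: h2.
Qed.

Lemma partial_rowD s t y y' :
  partial_row s t (y + y') = partial_row s t y + y' *: delta_mx 0 last.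
Proof.
apply/rowP => i; rewrite -(splitK i); case: (fintype.split i) => j /=.
  by rewrite row_lineE !partial_rowEl eq_lrshift mulr0 addr0.
by rewrite row_lineE (ord1 j) !partial_rowEr eqxx mulr1.
Qed.

(** With all parameters frozen nothing depends on t: a single coefficient at exponent 0, smooth by
    the tower in the last coordinate and bounded by continuity at [z0]. *)
Lemma expands_at_base l : expands_at x0 (fun t y => ipartial l g (partial_row [::] t y)).
Proof.
have z00 t : partial_row [::] t x0 = z0.
  by rewrite /partial_row /z0; congr row_mx; apply/rowP => i; rewrite mxE.
have Uz0 : U z0 by apply: boxU => i; rewrite subrr normr0.
have [c _] := sg l Uz0; have [r r_gt0 hr] := continuous_box c.
pose d := Num.min r r0; have d0 : 0 < d by rewrite lt_min r_gt0.
have inbox y : ball x0 d y -> forall i, `|partial_row [::] 0 y 0 i - z0 0 i| < d.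
  move=> yd; apply: boxE => [i|].
    by rewrite partial_rowEl in_nil subrr normr0.
  by rewrite partial_rowEr distrC.
exists d => //; apply: (@expands_fun _ _ (fun y => ipartial l g (partial_row [::] 0 y)) (`|ipartial l g z0| + 1)).
- exact: ball_open.
- apply: (@tower_smooth1 _ _ _ (fun k y => ipartial (nseq k last ++ l) g (partial_row [::] 0 y))) => //.
    exact: ball_open.
  move=> k y yd; have E : partial_row [::] 0 = fun y => partial_row [::] 0 0 + y *: delta_mx 0 last.
    by apply/funext => y'; rewrite -partial_rowD add0r.
  rewrite E; apply: ipartial_line => //; rewrite -partial_rowD add0r.
  by apply: boxU => i; rewrite (lt_le_trans (inbox _ yd i))// ge_min lexx orbT.
- move=> y yd; apply: hr => i.
  by rewrite (lt_le_trans (inbox _ yd i))// ge_min lexx.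
Qed.

Lemma fermat_vec_near e : 0 < e -> \forall t \near at0 R, forall i, `|q t 0 i - q 0 0 i| < e.
Proof. by move=> e0; apply: filter_forall => i; exact: fermat_near (fq i) e0. Qed.

(* One-variable Taylor expansions in one coordinate of q after the other. *)
Lemma expands_at_partial_row s l :
  expands_at x0 (fun t y => ipartial l g (partial_row s t y)).
Proof.
(* The list l must vary: the Taylor coefficients in coordinate j are further partial derivatives, to
   which the hypothesis for s is applied. *)
elim: s l => [|j s IH] l; first exact: expands_at_base.
have [js|jns] := boolP (j \in s).
  apply: expands_at_eq (IH l) => t y; rewrite /partial_row; congr (ipartial _ _ (row_mx _ _)).
  by apply/rowP => i; rewrite !mxE inE; case: eqP => // ->; rewrite js.
pose x t := q t 0 j.
have [N oN] := fermat_pow_o (fq j : fermat x).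
pose lj := lshift 1 j.
pose F k t y := ipartial (nseq k lj ++ l) g (partial_row s t y).
have e1 : expands_at x0 (fun t y => \sum_(k < N) F k t y / k`!%:R * (x t - x 0) ^+ k).
  apply: expands_at_sum => k; have [d d0 e] := IH (nseq k lj ++ l).
  exists d => //; have ob := ball_open x0 d.
  have := expands_fermatX k ob (fq j : fermat x) (expandsZ (k`!%:R^-1) ob e).
  by apply: expands_eq => t y; rewrite /F mulrC; congr (_ * _); exact: mulrC.
(* The Taylor remainder is o(t) uniformly in y, since one constant M bounds the N-th partial
   derivative on a box around [z0] that contains all the segments involved. *)
suff e2 : expands_at x0 (fun t y => ipartial l g (partial_row (j :: s) t y) -
    \sum_(k < N) F k t y / k`!%:R * (x t - x 0) ^+ k).
  by apply: expands_at_eq (expands_atD e2 e1) => t y; rewrite subrK.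
have Uz0 : U z0 by apply: boxU => i; rewrite subrr normr0.
have [c _] := sg (nseq N lj ++ l) Uz0; have [r r_gt0 hr] := continuous_box c.
set M := _ + 1 in hr.
pose d := Num.min r r0; have d0 : 0 < d by rewrite lt_min r_gt0.
exists d => //; apply: expands_uo; first exact: ball_open.
move=> eps eps0; have /is_oE/(_ _ eps0) h := oN M.
apply: filterS2 h (fermat_vec_near d0) => t h qt y yd.
apply: le_trans (h y I); apply: le_trans (ler_norm _).
have inbox (a : R) : `|a| <= `|x t - x 0| ->
    forall i, `|(partial_row s t y + a *: delta_mx 0 lj) 0 i - z0 0 i| < d.
  move=> ax; apply: boxE => [i|].
    rewrite row_lineE partial_rowEl.
    rewrite (inj_eq (@lshift_inj _ _)); have [->|ij] := eqVneq i j.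
      by rewrite (negbTE jns) mulr1 addrAC subrr add0r (le_lt_trans ax)// qt.
    rewrite mulr0 addr0; case: ifP => _; first exact: qt.
    by rewrite subrr normr0.
  by rewrite row_lineE partial_rowEr eq_rlshift mulr0 addr0 distrC.
have ->: partial_row (j :: s) t y = partial_row s t y + (x t - x 0) *: delta_mx 0 lj.
  apply/rowP => i; rewrite -(splitK i); case: (fintype.split i) => i' /=.
    rewrite row_lineE !partial_rowEl (inj_eq (@lshift_inj _ _)) inE.
    have [->|ij] := eqVneq i' j; first by rewrite (negbTE jns) mulr1 addrC subrK.
    by rewrite mulr0 addr0.
  by rewrite row_lineE (ord1 i') !partial_rowEr eq_rlshift mulr0 addr0.
have := @taylor_bound R N (fun k a => ipartial (nseq k lj ++ l) g (partial_row s t y + a *: delta_mx 0 lj)) 0 (x t - x 0) M.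
rewrite subr0; under eq_bigr do rewrite scale0r addr0.
apply.
- move=> k a kN; rewrite subr0 => ax; apply: ipartial_line => //.
  by apply: boxU => i; rewrite (lt_le_trans (inbox _ ax i))// ge_min lexx orbT.
- move=> a; rewrite subr0 => ax; apply: hr => i.
  by rewrite (lt_le_trans (inbox _ ax i))// ge_min lexx.
Qed.

End Coordinates.

(** Terms with exponent above 1 have bounded coefficients and are discarded as o(t); what remains is
    in the range where coefficients are unique. *)
Lemma expands_cut B H : open B -> expands B H -> exists bs c,
  [/\ coefs B bs c, {in bs, forall b, b <= 1} & uo B 1 (fun t y => H t y - nf bs c t y)].
Proof.
move=> oB [bs [c [[u p off s] cb uH]]].
exists [seq b <- bs | b <= 1], (fun b y => if b <= 1 then c b y else 0); split.
- split=> [|b|b y|b].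
  + exact: filter_uniq.
  + by rewrite mem_filter => /andP[_ /p].
  + rewrite mem_filter negb_and => /orP[/negbTE->//|/off ->].
    by case: ifP.
  + by case: (b <= 1) => //; exact: smooth1_cst.
- by move=> b; rewrite mem_filter => /andP[].
have u1 : uo B 1 (fun t y => \sum_(b <- [seq b <- bs | 1 < b]) c b y * t `^ b).
  apply: (@uo_sum _ _ _ B 1 (fun b t y => c b y * t `^ b)) => b.
  rewrite mem_filter => /andP[b1 _]; have [M hM] := cb b.
  exact: uo_powR hM.
apply: uo_eq (uoD uH u1) => t y _ _; rewrite /nf !big_filter.
rewrite (bigID (fun b => b <= 1) predT)/= opprD addrA.
under [X in _ - X + _]eq_bigl do rewrite -ltNge.
rewrite subrK; congr (_ - _); apply: eq_bigr => b b1; by rewrite b1.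
Qed.

Lemma expands_slice B H x0 : B x0 -> open B -> expands B H ->
  expands B (fun t _ => H t x0).
Proof.
move=> Bx oB [bs [c [[u p off s] cb uH]]]; exists bs, (fun b _ => c b x0); split.
- by split=> [|||b] //; [move=> b y; exact: off|exact: smooth1_cst].
- by move=> b; have [M hM] := cb b; exists M => y _; exact: hM.
- by move=> eps /uH; apply: filterS => t h y _; exact: h.
Qed.

Lemma pair_fun_row p (al : 'rV[R]_p -> R -> R) v (y : R) :
  pair_fun al (row_mx v (const_mx y)) = al v y.
Proof. by rewrite /pair_fun row_mxKl row_mxKr mxE. Qed.

Lemma nf_is_derive (bs : seq R) (c c' : R -> R -> R) (t y : R) :
  (forall b, b \in bs -> is_derive y 1 (c b) (c' b y)) ->
  is_derive y 1 (nf bs c t) (nf bs c' t y).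
Proof.
elim: bs => [|b bs IH] h.
  have -> : nf [::] c t = cst 0 by apply/funext => z; rewrite /nf big_nil.
  by rewrite /nf big_nil; exact: is_derive_cst.
have -> : nf (b :: bs) c t = (t `^ b \*: c b) + nf bs c t.
  by apply/funext => z; rewrite /nf big_cons mulrC.
have -> : nf (b :: bs) c' t y = t `^ b *: c' b y + nf bs c' t y.
  by rewrite /nf big_cons mulrC.
apply: is_deriveD; first by apply: is_deriveZ; apply: h; exact: mem_head.
by apply: IH => b' b'b; apply: h; rewrite inE b'b orbT.
Qed.

(* The y-derivative is expanded first and then integrated, which avoids
   permuting partial derivatives. *)
Lemma local_expansion p (P : set 'rV[R]_p) (V : set R) (al : 'rV[R]_p -> R -> R)
    (q : R -> 'rV[R]_p) (x0 : R) :
  open P -> open V -> fermat_vec q -> P (q 0) -> V x0 ->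
  smooth_on (pair_set P V) (pair_fun al) ->
  exists d bs c, [/\ 0 < d, coefs (ball x0 d) bs c, {in bs, forall b, b <= 1},
    uo (ball x0 d) 1 (fun t y => al (q t) y - nf bs c t y) &
    uo (ball x0 d) 1 (fun t y => derive1 (al (q t)) y - nf bs (fun b => derive1 (c b)) t y)].
Proof.
move=> oP oV fq Pq Vx sg; set g := pair_fun al in sg; set U := pair_set P V in sg.
have /nbhs_ballP[r1 r1_gt0 hr1] := open_nbhs_nbhs (conj oP Pq).
have /nbhs_ballP[r2 r2_gt0 hr2] := open_nbhs_nbhs (conj oV Vx).
pose r0 := Num.min r1 r2; have r0_gt0 : 0 < r0 by rewrite lt_min r1_gt0.
have boxU (z : 'rV[R]_(p + 1)) :
    (forall i, `|z 0 i - (row_mx (q 0) (const_mx x0) : 'rV[R]_(p + 1)) 0 i| < r0) -> U z.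
  move=> h; split.
    apply: hr1; split=> // i j; rewrite /ball/= (ord1 i) mxE distrC.
    by have := h (lshift 1 j); rewrite row_mxEl lt_min => /andP[].
  apply: hr2; rewrite /ball/= mxE distrC.
  by have := h (rshift p ord0); rewrite row_mxEr mxE lt_min => /andP[].
have rowE t y : partial_row q (enum 'I_p) t y = row_mx (q t) (const_mx y).
  by rewrite /partial_row; congr row_mx; apply/rowP => j; rewrite mxE mem_enum.
have ex := expands_at_partial_row r0_gt0 boxU sg fq (enum 'I_p).
have dal : \forall t \near at0 R, forall y, ball x0 r0 y ->
    is_derive y 1 (al (q t)) (ipartial [:: rshift p ord0] g (partial_row q (enum 'I_p) t y)).
  apply: filterS (fermat_vec_near fq r0_gt0) => t qt y yd.
  have E y' : al (q t) y' = g (partial_row q (enum 'I_p) t 0 + y' *: delta_mx 0 (rshift p ord0)).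
    by rewrite -partial_rowD add0r rowE /g pair_fun_row.
  rewrite (funext E) -[in partial_row _ _ _ y](add0r y) partial_rowD.
  apply: (ipartial_line sg [::] 0%N) => //.
  rewrite -partial_rowD add0r; apply: boxU; apply: boxE => [i|].
    by rewrite partial_rowEl mem_enum; exact: qt.
  by rewrite partial_rowEr distrC.
(* [e1] expands the y-derivative and [e2] the map itself. Of [e2] only the slice y = x0 is kept, to
   supply the constants of integration. *)
have [d1 d1_gt0 e1] := ex [:: rshift p ord0].
have [d2 d2_gt0 e2] := ex [::].
have [bs1 [e [ce e_le1 ue]]] := expands_cut (ball_open x0 d1) e1.
have [bs2 [k [ck k_le1 uk]]] := expands_cut (ball_open x0 d2)
  (expands_slice (ballxx x0 d2_gt0) (ball_open x0 d2) e2).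
pose m := Num.min r0 (Num.min d1 d2); have m_gt0 : 0 < m by rewrite lt_min r0_gt0 lt_min d1_gt0.
(* Strictly smaller than m, since [continuous_primitive] loses a margin at both ends. *)
pose d := m / 2; have d_gt0 : 0 < d by rewrite divr_gt0.
have dm : d < m by rewrite ltr_pdivrMr// ltr_pMr// ltr1n.
have sub r : m <= r -> ball x0 d `<=` ball x0 r.
  by move=> mr; apply: le_ball; rewrite (le_trans (ltW dm)).
have sub0 : ball x0 d `<=` ball x0 r0 by apply: sub; rewrite ge_min lexx.
have sub1 : ball x0 d `<=` ball x0 d1 by apply: sub; rewrite !ge_min lexx orbT.
have sub2 : ball x0 d `<=` ball x0 d2 by apply: sub; rewrite !ge_min lexx !orbT.
have [u1 p1 off1 s1] := ce; have [u2 p2 off2 s2] := ck.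
have prim b : exists C, forall y, ball x0 d y -> is_derive y 1 C (e b y).
  have md1 : m <= d1 by rewrite !ge_min lexx orbT.
  have := @continuous_primitive R (e b) (x0 - d1) (x0 + d1) _ (x0 - d) (x0 + d) _ _.
  case.
  - move=> y; rewrite -ltr_distlC => yd.
    exact: (smooth1_continuous (k := 0%N) (s1 b) yd).
  - by rewrite ltrD2l ltrN2 (lt_le_trans dm).
  - by rewrite ltrD2l (lt_le_trans dm).
  by move=> C hC; exists C => y yd; apply: hC; rewrite -ltr_distlC.
have [C hC] := choice prim.
(* Normalised to vanish at x0, so that the slice alone gives the value there; set to 0 off [bs1]
   because [coefs] demands it. *)
pose C1 b y := if b \in bs1 then C b y - C b x0 else 0.
have dC1 b y : ball x0 d y -> is_derive y 1 (C1 b) (e b y).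
  move=> yd; rewrite /C1; case bb: (b \in bs1).
    rewrite -[e b y]subr0; apply: is_deriveB; exact: hC.
  by rewrite off1 ?bb//; exact: is_derive_cst.
have cC1 : coefs (ball x0 d) bs1 C1.
  split=> // [b y bn|b]; first by rewrite /C1 (negbTE bn).
  apply: (smooth1_primitive (c := e b)); [exact: ball_open|exact: smooth1_sub (s1 b)].
pose k1 b (_ : R) := k b x0.
have ck1 : coefs (ball x0 d) bs2 k1.
  split=> // [b y bn|b]; first by rewrite /k1 off2.
  by apply: smooth1_cst; exact: ball_open.
have [cU nfC nfk] := coefs_merge (ball_open x0 d) cC1 ck1.
set bs := undup _ in cU nfC nfk; set c := fun b y => _ in cU.
have dc b y : ball x0 d y -> derive1 (c b) y = e b y.
  move=> yd; rewrite derive1E.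
  have : is_derive y 1 (c b) (e b y + 0) by apply: is_deriveD; exact: dC1.
  by rewrite addr0 => -[].
have nfc t y : nf bs c t y = nf bs1 C1 t y + nf bs2 k1 t y.
  rewrite -nfC -nfk /nf -big_split; apply: eq_bigr => b _.
  by rewrite mulrDl.
exists d, bs, c; split=> //.
- by move=> b; rewrite mem_undup mem_cat => /orP[/e_le1|/k_le1].
- pose w t y := al (q t) y - nf bs1 C1 t y.
  (* Mean value estimate in y: by [ue] the y-derivative of w is uniformly o(t), and y is closer than
     d to x0. The factor d + 1 in the tolerance absorbs that distance. *)
  have uw : uo (ball x0 d) 1 (fun t y => w t y - w t x0).
    move=> eps eps0; have eps1 : 0 < eps / (d + 1) by rewrite divr_gt0// ltr_wpDl// ltW.
    have := ue _ eps1; apply: filterS3 (at0_ge0 R) dal => t t0 dt ht y yd.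
    have := @derive_bound R (w t) (fun y => ipartial [:: rshift p ord0] g (partial_row q (enum 'I_p) t y) - nf bs1 e t y) x0 y (eps / (d + 1) * t `^ 1).
    have in_ball z : `|z - x0| <= `|y - x0| -> ball x0 d z.
      by move=> zy; rewrite /ball/= distrC (le_lt_trans zy)// distrC.
    move=> h; apply: (le_trans (h _ _)).
    + move=> z /in_ball zd; apply: is_deriveB; first by apply: dt; exact: sub0.
      by apply: nf_is_derive => b _; exact: dC1.
    + by move=> z /in_ball /sub1 zd; exact: ht.
    rewrite mulrAC; apply: ler_wpM2r; first exact: powR_ge0.
    have d1' : 0 < d + 1 by rewrite ltr_wpDl// ltW.
    rewrite mulrAC ler_pdivrMr//; apply: (ler_wpM2l (ltW eps0)).
    by rewrite distrC ltW// (lt_trans yd)// ltrDl.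
  have uk' : uo (ball x0 d) 1 (fun t _ => al (q t) x0 - nf bs2 k t x0).
    move=> eps eps0; apply: filterS (uk _ eps0) => t h y _.
    by have := h x0 (ballxx _ d2_gt0); rewrite /= rowE /g pair_fun_row.
  apply: uo_eq (uoD uw uk') => t y _ _.
  have C0 : nf bs1 C1 t x0 = 0.
    by rewrite /nf big1// => b _; rewrite /C1 subrr if_same mul0r.
  have -> : nf bs2 k t x0 = nf bs2 k1 t y by [].
  by rewrite /w nfc C0; ring.
- have E t y : ball x0 d y -> nf bs (fun b => derive1 (c b)) t y = nf bs1 e t y.
    move=> yd; transitivity (nf bs e t y).
      by apply: eq_bigr => b _; rewrite dc.
    apply: nf_subset => //; first exact: undup_uniq.
    by move=> b bb; rewrite mem_undup mem_cat bb.
  move=> eps /ue; apply: filterS2 dal => t dt h y yd.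
  rewrite E// derive1E; have := dt y (sub0 _ yd) => -[_ ->].
  by apply: h; exact: sub1.
Qed.

End LocalExpansion.

(** * Normal forms of a smooth map on [a, b]: existence, uniqueness, gluing *)

Section NormalForm.
Variable R : realType.
Implicit Types (W : set R) (c : R -> R -> R) (x : R -> R).

Lemma fermat_cst (k : R) : fermat (fun=> k).
Proof.
by apply: (expands_is_fermat (y := 0) I); apply: expands_cst; exact: openT.
Qed.

Lemma fermat_in_open W x : open W -> fermat x -> W (x 0) ->
  \forall t \near at0 R, W (x t).
Proof.
move=> oW fx Wx; have /nbhs_ballP[r r0 hr] := open_nbhs_nbhs (conj oW Wx).
by apply: filterS (fermat_near fx r0) => t h; apply: hr; rewrite /ball/= distrC.
Qed.

Lemma fequivP (x y : R -> R) : fequiv x y <-> uo setT 1 (fun t _ => x t - y t).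
Proof. exact: is_oE. Qed.

Lemma fequiv_near (x y : R -> R) : x 0 = y 0 -> (\forall t \near at0 R, x t = y t) -> fequiv x y.
Proof.
move=> xy0 h; apply/fequivP => eps eps0; apply: filterS2 (at0_ge0 R) h => t t0 -> z _.
by rewrite subrr normr0 mulr_ge0// ?powR_ge0// ltW.
Qed.

Lemma fequiv_refl x : fequiv x x.
Proof. by apply: fequiv_near => //; apply: filterE. Qed.

Lemma fequiv_sym (x y : R -> R) : fequiv x y -> fequiv y x.
Proof.
by move/fequivP => h; apply/fequivP; apply: uo_eq (uoN h) => t z _ _; rewrite opprB.
Qed.

Lemma fequiv_trans (y x z : R -> R) : fequiv x y -> fequiv y z -> fequiv x z.
Proof.
move=> /fequivP h /fequivP h'; apply/fequivP; apply: uo_eq (uoD h h') => t w _ _.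
by rewrite addrA subrK.
Qed.

Lemma fequivB (x y x' y' : R -> R) : fequiv x x' -> fequiv y y' ->
  fequiv (fun t => x t - y t) (fun t => x' t - y' t).
Proof.
move=> /fequivP h /fequivP h'; apply/fequivP; apply: uo_eq (uoB h h') => t w _ _.
by ring.
Qed.

Lemma fequiv_uo W x (w w' : R -> R -> R) : open W -> fermat x -> W (x 0) ->
  uo W 1 (fun t y => w t y - w' t y) -> fequiv (fun t => w t (x t)) (fun t => w' t (x t)).
Proof.
move=> oW fx Wx u; apply: (@uo_is_o _ W x (fun t y => w t y - w' t y)) => //.
exact: fermat_in_open.
Qed.

Lemma coefs_sub W W' bs c : W' `<=` W -> coefs W bs c -> coefs W' bs c.
Proof. by move=> sW [u p off s]; split=> // b; exact: smooth1_sub (s b). Qed.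

Definition oo (l r : R) := [set y : R | l < y < r].

Lemma oo_open l r : open (oo l r).
Proof.
have -> : oo l r = [set` `]l, r[] by apply/seteqP; split=> y; rewrite /= in_itv.
exact: interval_open.
Qed.

Lemma ball_oo (x0 d : R) : ball x0 d = oo (x0 - d) (x0 + d).
Proof. by apply/seteqP; split=> y; rewrite /oo /ball/= ltr_distlC. Qed.

Variables (a b : R -> R).
Hypotheses (fa : fermat a) (fb : fermat b) (ab : a 0 < b 0).
Let S := fint a b.

Lemma fle_at0 (x y : R -> R) : fle x y -> x 0 <= y 0.
Proof.
move=> [z [zo [d d0 h]]]; have := h 0 (lexx _) d0.
by have := is_o_at0 zo; rewrite subr0 => ->; rewrite addr0.
Qed.

Lemma fle_near (x y : R -> R) : (\forall t \near at0 R, x t <= y t) -> fle x y.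
Proof.
move=> /at0P[d d0 h]; exists (fun=> 0); split; first exact: fequiv_refl.
by exists d => // t t0 td; rewrite addr0 h.
Qed.

Lemma fle_lt (x y : R -> R) : fermat x -> fermat y -> x 0 < y 0 -> fle x y.
Proof.
move=> fx fy xy; apply: fle_near.
have e0 : 0 < (y 0 - x 0) / 2 by rewrite divr_gt0// subr_gt0.
apply: filterS2 (fermat_near fx e0) (fermat_near fy e0) => t.
rewrite !ltr_distl => /andP[_ h1] /andP[h2 _]; apply: ltW.
by rewrite (lt_trans h1)// (le_lt_trans _ h2)//; lra.
Qed.

Lemma fint_fermat x : S x -> fermat x.
Proof. by case. Qed.

Lemma fint_bounds x : S x -> a 0 <= x 0 <= b 0.
Proof. by move=> [_ [/fle_at0 -> /fle_at0 ->]]. Qed.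

Lemma fint_cst (s : R) : a 0 < s < b 0 -> S (fun=> s).
Proof.
move=> /andP[sa sb]; split; first exact: fermat_cst.
by split; apply: fle_lt => //; exact: fermat_cst.
Qed.

(** The constant [a 0] can lie below a and hence outside [a, b], and likewise [b 0] above b; at the
    ends a and b themselves are the witnesses. *)
Lemma fint_ex (s : R) : a 0 <= s <= b 0 -> exists2 x, S x & x 0 = s.
Proof.
move=> /andP[]; rewrite le_eqVlt => /predU1P[<- _|sa].
  exists a => //; split=> //; split; last exact: fle_lt.
  by apply: fle_near; apply: filterE.
rewrite le_eqVlt => /predU1P[->|sb].
  exists b => //; split=> //; split; first exact: fle_lt.
  by apply: fle_near; apply: filterE.
by exists (fun=> s) => //; apply: fint_cst; rewrite sa.
Qed.

Definition nfrep (f : (R -> R) -> R -> R) W bs c :=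
  [/\ coefs W bs c, {in bs, forall e, e <= 1} &
   forall x, S x -> W (x 0) -> fequiv (f x) (fun t => nf bs c t (x t))].

(** Since [fderiv] is existential in the representation, the last clause is what gives access to it:
    whichever one is used, its derivative is read off from the coefficients. *)
Lemma nfrep_local f x V p P q al : S x -> @local_rep R S f x V p P q al ->
  exists d bs c, [/\ 0 < d, nfrep f (ball (x 0) d) bs c &
    fequiv (fun t => derive1 (al (q t)) (x t))
           (fun t => nf bs (fun e => derive1 (c e)) t (x t))].
Proof.
move=> Sx [[oV Vx oP fq Pq] [sal h]].
have [d [bs [c [d0 cf le1 u u']]]] := local_expansion oP oV fq Pq Vx sal.
have /nbhs_ballP[r r0 hr] := open_nbhs_nbhs (conj oV Vx).
exists (Num.min d r), bs, c; split; first by rewrite lt_min d0.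
  have sb : ball (x 0) (Num.min d r) `<=` ball (x 0) d.
    by apply: le_ball; rewrite ge_min lexx.
  split=> //; first exact: coefs_sub cf.
  move=> y Sy yd; have Vy : V (y 0).
    by apply: hr; apply: le_ball yd; rewrite ge_min lexx orbT.
  apply: fequiv_trans (h y Sy Vy) _.
  apply: (@fequiv_uo (ball (x 0) d) y (fun t z => al (q t) z)) => //.
  - exact: ball_open.
  - exact: fint_fermat.
  - exact: sb.
apply: (@fequiv_uo (ball (x 0) d) x (fun t z => derive1 (al (q t)) z)) => //.
- exact: ball_open.
- exact: fint_fermat.
- exact: ballxx.
Qed.

Lemma nf_fequiv_eq W W' bs bs' c c' (s s' : R) : open W -> open W' ->
  coefs W bs c -> coefs W' bs' c' ->
  {in bs, forall e, e <= 1} -> {in bs', forall e, e <= 1} ->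
  fequiv (fun t => nf bs c t s) (fun t => nf bs' c' t s') -> forall e, c e s = c' e s'.
Proof.
move=> oW oW' [u p off _] [u' p' off' _] l l' h e.
pose U := undup (bs ++ bs').
have uU : uniq U by exact: undup_uniq.
have [eU|] := boolP (e \in U); last first.
  by rewrite mem_undup mem_cat negb_or => /andP[/off -> /off' ->].
apply/eqP; rewrite -subr_eq0; apply/eqP.
apply: (@powR_sum_o_eq0 R U (fun e => c e s - c' e s')) eU => //.
  move=> e'; rewrite mem_undup mem_cat => /orP[] h'.
    by rewrite p// l.
  by rewrite p'// l'.
move: h; congr is_o; apply/funext => t.
rewrite -(@nf_subset _ bs U c)//; last by move=> e'; rewrite mem_undup mem_cat => ->.
rewrite -(@nf_subset _ bs' U c')//; last by move=> e'; rewrite mem_undup mem_cat orbC => ->.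
by rewrite /nf -sumrB; apply: eq_bigr => e' _; rewrite mulrBl.
Qed.

Lemma nfrep_unique f W W' bs bs' c c' s : open W -> open W' ->
  nfrep f W bs c -> nfrep f W' bs' c' -> W s -> W' s -> a 0 < s < b 0 ->
  forall e, c e s = c' e s.
Proof.
move=> oW oW' [cf l h] [cf' l' h'] Ws Ws' sab.
apply: (nf_fequiv_eq oW oW' cf cf' l l').
have Ss := fint_cst sab.
exact: fequiv_trans (fequiv_sym (h _ Ss Ws)) (h' _ Ss Ws').
Qed.

Lemma nfrep_eq f W bs c c' : open W -> (forall e y, W y -> c e y = c' e y) ->
  (forall e y, e \notin bs -> c' e y = 0) ->
  nfrep f W bs c -> nfrep f W bs c'.
Proof.
move=> oW cc off' [[u p off s] l h]; split=> //.
  by split=> // e; apply: smooth1_eq (s e) => // y; exact: cc.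
move=> x Sx Wx; apply: fequiv_trans (h x Sx Wx) _.
apply: fequiv_near; first by apply: eq_bigr => e _; rewrite cc.
apply: filterS (fermat_in_open oW (fint_fermat Sx) Wx) => t Wt.
by apply: eq_bigr => e _; rewrite cc.
Qed.

(** Brings two forms to a common list before gluing; the added exponents carry coefficient 0. *)
Lemma nfrep_widen f W bs bs' c : uniq bs' -> {subset bs <= bs'} ->
  {in bs', forall e, 0 <= e <= 1} -> nfrep f W bs c -> nfrep f W bs' c.
Proof.
move=> u' sub p' [[u p off s] l h]; split.
- split=> //.
  + by move=> e /p' /andP[].
  + move=> e y en; apply: off; apply: contra en; exact: sub.
- by move=> e /p' /andP[].
- move=> x Sx Wx; move: (h x Sx Wx); congr fequiv; apply/funext => t.
  by rewrite (@nf_subset _ bs bs').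
Qed.

(** The two forms may disagree outside ]a 0, b 0[, so they are joined at a point s inside it:
    coefficients from the left form before s, from the right form after. *)
Lemma nfrep_glue f l r bs c l' r' bs' c' s :
  nfrep f (oo l r) bs c -> nfrep f (oo l' r') bs' c' ->
  a 0 < s < b 0 -> oo l r s -> oo l' r' s ->
  exists bs c, nfrep f (oo l r') bs c.
Proof.
move=> n n' /andP[as_ sb] /andP[ls sr] /andP[ls' sr'].
pose U := undup (bs ++ bs').
have uU : uniq U by exact: undup_uniq.
have pU : {in U, forall e, 0 <= e <= 1}.
  case: n n' => [[_ p _ _] k _] [[_ p' _ _] k' _] e.
  by rewrite mem_undup mem_cat => /orP[h|h]; [rewrite p// k|rewrite p'// k'].
have bU : {subset bs <= U} by move=> e; rewrite mem_undup mem_cat => ->.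
have bU' : {subset bs' <= U} by move=> e; rewrite mem_undup mem_cat orbC => ->.
have {bU}n := nfrep_widen uU bU pU n; have {bU'}n' := nfrep_widen uU bU' pU n'.
pose g e y := if y < s then c e y else c' e y.
(* Between m' and m lies the part of the overlap where uniqueness applies. As s is in it, the joined
   coefficient is smooth across s. *)
pose m := Num.min r (Num.min r' (b 0)); pose m' := Num.max l (Num.max l' (a 0)).
have sm : s < m by rewrite !lt_min sr sr' sb.
have ms : m' < s by rewrite !gt_max ls ls' as_.
have cc e y : oo m' m y -> c e y = c' e y.
  rewrite /oo/= !gt_max !lt_min => /andP[/and3P[h1 h2 h3] /and3P[h4 h5 h6]].
  apply: (nfrep_unique (@oo_open l r) (@oo_open l' r') n n').
  - by rewrite /oo/= h1.
  - by rewrite /oo/= h2.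
  - by rewrite h3.
have off e y : e \notin U -> g e y = 0.
  case: n n' => [[_ _ o _] _ _] [[_ _ o' _] _ _] eU; rewrite /g.
  by rewrite (o _ _ eU) (o' _ _ eU) if_same.
have n1 : nfrep f (oo l m) U g.
  apply: (nfrep_eq (c := c)) => //; first exact: oo_open.
    move=> e y /andP[ly ym]; rewrite /g; case: ltP => // sy; apply: cc.
    by rewrite /oo/= ym (lt_le_trans ms).
  case: n => cf k h; split=> //.
    apply: coefs_sub cf => y /andP[h1]; rewrite !lt_min => /andP[h2 _].
    by rewrite /oo/= h1.
  move=> x Sx /andP[h1]; rewrite !lt_min => /andP[h2 _]; apply: h => //.
  by rewrite /oo/= h1.
have n2 : nfrep f (oo m' r') U g.
  apply: (nfrep_eq (c := c')) => //; first exact: oo_open.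
    move=> e y /andP[ly ym]; rewrite /g; case: ltP => // sy; apply: esym; apply: cc.
    by rewrite /oo/= ly (lt_trans sy).
  case: n' => cf k h; split=> //.
    apply: coefs_sub cf => y /andP[]; rewrite !gt_max => /and3P[_ h1 _] h2.
    by rewrite /oo/= h1.
  move=> x Sx /andP[]; rewrite !gt_max => /and3P[_ h1 _] h2; apply: h => //.
  by rewrite /oo/= h1.
have cover y : oo l r' y -> oo l m y \/ oo m' r' y.
  move=> /andP[h1 h2]; case: (ltP y s) => ys.
    by left; rewrite /oo/= h1 (lt_trans ys).
  by right; rewrite /oo/= h2 (lt_le_trans ms).
exists U, g; case: n1 n2 => [[_ p1 _ s1] k1 h1] [[_ _ _ s2] _ h2]; split=> //.
- split=> // e.
  by apply: smooth1_sub (smooth1U (s1 e) (s2 e)) => y /cover.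
- by move=> x Sx /cover[]; [exact: h1|exact: h2].
Qed.

(** Compactness of [a 0, b 0] by a supremum: a form reaching up to near the supremum is prolonged
    past it by the local form there. *)
Lemma nfrep_global f : fsmooth S f -> exists l r bs c,
  [/\ l < a 0, b 0 < r & nfrep f (oo l r) bs c].
Proof.
move=> [ff sf].
have loc (s : R) : a 0 <= s <= b 0 -> exists d bs c,
    0 < d /\ nfrep f (oo (s - d) (s + d)) bs c.
  move=> /fint_ex[x Sx <-]; have [V [p [P [q [al h]]]]] := sf x Sx.
  have [d [bs [c [d0 n _]]]] := nfrep_local Sx h.
  by exists d, bs, c; rewrite -ball_oo.
pose good s := exists l r bs c, [/\ l < a 0, s < r & nfrep f (oo l r) bs c].
suff : good (b 0) by [].
pose A := [set s | [/\ a 0 <= s, s <= b 0 & good s]].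
have Aa : A (a 0).
  split=> //; first exact: ltW.
  have [|d [bs [c [d0 n]]]] := loc (a 0); first by rewrite lexx ltW.
  by exists (a 0 - d), (a 0 + d), bs, c; rewrite ltrDl gtrDl oppr_lt0.
have ubA : ubound A (b 0) by move=> s [].
have hsA : has_sup A by split; [exists (a 0)|exists (b 0)].
have as_ : a 0 <= sup A by apply: ub_le_sup => //; exists (b 0).
have sb : sup A <= b 0 by apply: ge_sup => //; exists (a 0).
have [|d [bs [c [d0 n]]]] := loc (sup A); first by rewrite as_.
have step s' : s' < sup A + d -> good s'.
  (* If the supremum is [a 0], no gluing point inside is available to its left, but the local form
     already begins before [a 0]. *)
  move=> s'd; move: as_; rewrite le_eqVlt => /predU1P[as_|as_].
    exists (sup A - d), (sup A + d), bs, c; split=> //.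
    by rewrite -as_ gtrDl oppr_lt0.
  pose m := Num.max (a 0) (sup A - d).
  have m0 : 0 < sup A - m.
    by rewrite subr_gt0 gt_max as_ gtrDl oppr_lt0.
  have [s [s1 s2 [l [r [bs1 [c1 [la sr n1]]]]]]] := sup_adherent m0 hsA.
  rewrite opprB addrC subrK => ms.
  have sA : s <= sup A.
    by apply: ub_le_sup; [exists (b 0)|split=> //; exists l, r, bs1, c1].
  (* A gluing point strictly between [a 0] and [b 0] and in both domains: m is at least [a 0] and
     [sup A - d], and s is at most [sup A]. *)
  pose s0 := (m + s) / 2.
  have ms0 : m < s0 by rewrite /s0; lra.
  have s0s : s0 < s by rewrite /s0; lra.
  have am : a 0 <= m by rewrite le_max lexx.
  have dm : sup A - d <= m by rewrite le_max lexx orbT.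
  have [|||bs' [c' n']] := nfrep_glue n1 n (s := s0).
  - by rewrite (le_lt_trans am)//= (lt_le_trans s0s).
  - by rewrite /oo/= (lt_trans la) ?(le_lt_trans am)//= (lt_trans s0s).
  - rewrite /oo/= (le_lt_trans dm)//= (lt_le_trans s0s)// (le_trans sA)// lerDl ltW//.
  by exists l, (sup A + d), bs', c'.
(* This point is good, so it cannot exceed the supremum; hence the minimum is [b 0], and one more
   step passes it. *)
pose s' := Num.min (b 0) (sup A + d / 2).
have d2 : 0 < d / 2 by rewrite divr_gt0.
have s'd : s' < sup A + d.
  by rewrite gt_min ltrD2l ltr_pdivrMr// ltr_pMr// ltr1n orbT.
have : s' <= sup A.
  apply: ub_le_sup; first by exists (b 0).
  split; [|by rewrite ge_min lexx|exact: step].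
  by rewrite le_min (ltW ab)/= (le_trans as_)// lerDl ltW.
rewrite ge_min leNgt -leNgt => /orP[h|]; last by rewrite gerDl leNgt d2.
by apply: step; rewrite (le_lt_trans h)// ltrDl.
Qed.

End NormalForm.

(** * Joint smoothness of families linear in their parameters *)

Section LinearFamily.
Variable R : realType.

Lemma smooth1_derive1 (W : set R) (c : R -> R) : smooth1 W c -> smooth1 W (derive1 c).
Proof.
by move=> [sc]; split=> k y Wy; rewrite -derive1Sn; exact: sc.
Qed.

(** The way from a normal form back to a map admissible in [local_rep]: the powers of t are fed in
    as parameters v, so no smoothness in t is ever required. *)
Definition linear_family n (C : 'I_n -> R -> R) (v : 'rV[R]_n) (y : R) : R :=
  \sum_(j < n) v 0 j * C j y.

Variables (n : nat) (W : set R).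
Hypothesis oW : open W.
Let last := rshift n (@ord0 0).
Let U := pair_set (@setT 'rV[R]_n) W.

(** A class closed under every partial derivative, unlike the linear families: parameter direction j
    sends (D, E) to (0, D j), and the last direction differentiates D and E. *)
Definition affine_fun (D : 'I_n -> R -> R) (E : R -> R) (z : 'rV[R]_(n + 1)) : R :=
  \sum_(j < n) z 0 (lshift 1 j) * D j (z 0 (rshift n ord0)) + E (z 0 (rshift n ord0)).

Lemma cylinderE : U = (fun z : 'rV[R]_(n + 1) => z 0 last) @^-1` W.
Proof. by apply/seteqP; split=> z; rewrite /U/pair_set/= mxE => // -[]. Qed.

Lemma cylinder_open : open U.
Proof.
by rewrite cylinderE; apply: open_comp => // z _; exact: coord_continuous.
Qed.

Lemma affine_fun_continuous D E z : (forall j, smooth1 W (D j)) -> smooth1 W E ->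
  U z -> {for z, continuous (affine_fun D E)}.
Proof.
move=> sD sE; rewrite cylinderE /= => Wz.
have c0 (G : R -> R) : smooth1 W G ->
    (fun z : 'rV[R]_(n + 1) => G (z 0 last)) @ z --> G (z 0 last).
  move=> sG; have cG := smooth1_continuous (k := 0%N) sG Wz.
  by apply: continuous_comp cG; exact: coord_continuous.
have cs (r : seq 'I_n) : {for z, continuous (\sum_(j <- r)
    (fun z : 'rV[R]_(n + 1) => z 0 (lshift 1 j) * D j (z 0 last)) : 'rV[R]_(n + 1) -> R)}.
  elim: r => [|j r IH]; first by rewrite big_nil; apply: cvg_cst; exact: nbhs_filter.
  rewrite big_cons; apply: cvgD IH; apply: cvgM; last exact: c0.
  exact: coord_continuous.
have -> : affine_fun D E = (\sum_(j < n)
    (fun z : 'rV[R]_(n + 1) => z 0 (lshift 1 j) * D j (z 0 last))) + (fun z => E (z 0 last)).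
  by apply/funext => z'; rewrite /affine_fun /= fct_sumE.
exact: (cvgD (cs _) (c0 E sE)).
Qed.

Lemma affine_fun_derive D E i : (forall j, smooth1 W (D j)) -> smooth1 W E ->
  exists D' E', [/\ forall j, smooth1 W (D' j), smooth1 W E' &
    forall z, U z -> is_derive z (delta_mx 0 i) (affine_fun D E) (affine_fun D' E' z)].
Proof.
move=> sD sE; rewrite -(splitK i); case: (fintype.split i) => j /=.
  exists (fun _ _ => 0), (D j); split=> // [j'|z Uz]; first exact: smooth1_cst.
  suff : is_derive (z + 0 *: delta_mx 0 (lshift 1 j)) (delta_mx 0 (lshift 1 j))
      (affine_fun D E) (affine_fun (fun _ _ => 0) (D j) z) by rewrite scale0r addr0.
  apply/derive_line.
  have -> : (fun s => affine_fun D E (z + s *: delta_mx 0 (lshift 1 j))) =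
      cst (affine_fun D E z) + (D j (z 0 last) \*: id).
    apply/funext => s; rewrite /affine_fun row_lineE eq_rlshift mulr0 addr0.
    rewrite [RHS]/= -/last addrAC; congr (_ + _).
    rewrite (bigD1 j)//= [in RHS](bigD1 j)//= row_lineE eqxx mulr1 mulrDl.
    rewrite -!addrA; congr (_ + _); rewrite addrC; congr (_ + _); last exact: mulrC.
    apply: eq_bigr => j' j'j; rewrite row_lineE (inj_eq (@lshift_inj _ _)).
    by rewrite (negbTE j'j) mulr0 addr0.
  apply: is_derive_eq.
  by rewrite /affine_fun big1 ?add0r => [|? _]; rewrite ?mulr0// [_ *: _]mulr1.
have -> : j = ord0 by rewrite (ord1 j).
exists (fun j => derive1 (D j)), (derive1 E); split=> [j'||z].
- exact: smooth1_derive1.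
- exact: smooth1_derive1.
rewrite cylinderE /= => Wz.
pose F : R -> R := (\sum_(j < n) (z 0 (lshift 1 j) \*: D j)) + E.
have dF : is_derive (z 0 last + 0 *: 1) 1 F
    (affine_fun (fun j => derive1 (D j)) (derive1 E) z).
  rewrite scale0r addr0; apply: is_deriveD; last first.
    exact: (smooth1_is_derive 0%N sE Wz).
  apply: is_derive_sum => k; apply: is_deriveZ.
  exact: (smooth1_is_derive 0%N (sD k) Wz).
suff : is_derive (z + 0 *: delta_mx 0 last) (delta_mx 0 last)
    (affine_fun D E) (affine_fun (fun j => derive1 (D j)) (derive1 E) z).
  by rewrite scale0r addr0.
apply/derive_line; move: ((derive_line F (z 0 last) 1 0 _).2 dF).
congr is_derive; apply/funext => s.
rewrite /F /affine_fun row_lineE eqxx mulr1 [s *: 1]mulr1 /= fct_sumE.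
congr (_ + _); apply: eq_bigr => k _.
by rewrite row_lineE eq_lrshift mulr0 addr0.
Qed.

Lemma linear_family_smooth (C : 'I_n -> R -> R) : (forall j, smooth1 W (C j)) ->
  smooth_on U (pair_fun (linear_family C)).
Proof.
move=> sC.
have ip l : exists D E, [/\ forall j, smooth1 W (D j), smooth1 W E &
    forall z, U z -> ipartial l (pair_fun (linear_family C)) z = affine_fun D E z].
  elim: l => [|i l [D [E [sD sE h]]]].
    exists C, (fun=> 0); split=> //; first exact: smooth1_cst.
    move=> z _; rewrite /= /pair_fun /linear_family /affine_fun addr0.
    by apply: eq_bigr => j _; rewrite !mxE.
  have [D' [E' [sD' sE' d]]] := affine_fun_derive i sD sE.
  exists D', E'; split=> // z Uz /=.
  have -> : 'D_(delta_mx 0 i) (ipartial l (pair_fun (linear_family C))) z =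
      'D_(delta_mx 0 i) (affine_fun D E) z.
    apply: near_eq_derive; have := open_nbhs_nbhs (conj cylinder_open Uz).
    by apply: filterS => z' Uz'; exact: h.
  by have [_ ->] := d z Uz.
move=> l z Uz; have [D [E [sD sE h]]] := ip l.
have hn : \forall z' \near z, affine_fun D E z' = ipartial l (pair_fun (linear_family C)) z'.
  have := open_nbhs_nbhs (conj cylinder_open Uz).
  by apply: filterS => z' Uz'; rewrite h.
split=> [|i].
  have c : affine_fun D E @ z --> affine_fun D E z by exact: affine_fun_continuous.
  rewrite -(h z Uz) in c; apply: cvg_trans c.
  by apply: near_eq_cvg; [exact: nbhs_filter|exact: hn].
have [D' [E' [_ _ d]]] := affine_fun_derive i sD sE.
by apply: near_eq_derivable hn _; have [] := d z Uz.
Qed.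

End LinearFamily.

(** * The coefficientwise primitive and its uniqueness *)

Section Primitive.
Variable R : realType.
Implicit Types (c C : R -> R -> R) (bs : seq R).

Lemma expands_nf B W bs C (x : R -> R) : open B -> open W -> coefs W bs C ->
  fermat x -> W (x 0) -> expands B (fun t _ => nf bs C t (x t)).
Proof.
move=> oB oW [_ p _ s] fx Wx; apply: expands_sum => // e /p e0.
have := expands_powR e0 (expands_comp oB oW (s e) fx Wx).
by apply: expands_eq => t y; exact: mulrC.
Qed.

Variables (a b u : R -> R).
Hypotheses (fa : fermat a) (fb : fermat b) (ab : a 0 < b 0).
Let S := fint a b.
Hypothesis Su : S u.

Variables (W : set R) (bs : seq R) (C : R -> R -> R).
Hypotheses (oW : open W) (cC : coefs W bs C) (le1 : {in bs, forall e, e <= 1}).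
Hypothesis SW : forall x, S x -> W (x 0).

Definition nf_primitive (x : R -> R) (t : R) := nf bs C t (x t) - nf bs C t (u t).

Let n := size bs.
(** The extra last parameter carries the constant of integration. That constant is a Fermat real,
    not a real number, so it cannot be put into the coefficient functions. *)
Let Cs (j : 'I_n.+1) (y : R) : R := if (j < n)%N then C (nth 0 bs j) y else 1.
Let q (t : R) : 'rV[R]_n.+1 :=
  \row_j (if (j < n)%N then t `^ nth 0 bs j else - nf bs C t (u t)).

Lemma linear_family_nf t y : linear_family Cs (q t) y = nf bs C t y - nf bs C t (u t).
Proof.
rewrite /linear_family big_ord_recr /= /Cs ltnn mxE /= ltnn mulr1; congr (_ + _).
rewrite /nf (big_nth 0) big_mkord; apply: eq_bigr => j _.
by rewrite mxE /= ltn_ord mulrC.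
Qed.

Lemma nf_primitive_rep x : S x ->
  @local_rep R S nf_primitive x W n.+1 setT q (linear_family Cs).
Proof.
move=> Sx; split; [split=> //|split].
- exact: SW.
- exact: openT.
- move=> j; have [jn|jn] := boolP (j < n)%N.
    apply: (@expands_is_fermat _ setT _ 0) => //.
    have e0 : 0 <= nth 0 bs j by case: cC => _ p _ _; apply: p; exact: mem_nth.
    apply: expands_eq (expands_powR e0 (expands_cst 1 openT)) => t y.
    by rewrite mulr1 mxE jn.
  apply: (@expands_is_fermat _ setT _ 0) => //.
  have := expandsN openT (expands_nf openT oW cC (fint_fermat Su) (SW Su)).
  by apply: expands_eq => t y; rewrite mxE (negbTE jn).
- apply: linear_family_smooth => // j; rewrite /Cs; case: (j < n)%N.
    by case: cC.
  exact: smooth1_cst.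
- move=> y Sy _; apply: fequiv_near => [|]; first by rewrite linear_family_nf.
  by apply: filterE => t; rewrite linear_family_nf.
Qed.

Lemma nf_primitive_smooth : fsmooth S nf_primitive.
Proof.
split=> x Sx; last first.
  by exists W, n.+1, setT, q, (linear_family Cs); exact: nf_primitive_rep.
apply: (@expands_is_fermat _ setT _ 0) => //; rewrite /nf_primitive.
apply: expandsD; first exact: openT.
  exact: (expands_nf openT oW cC (fint_fermat Sx) (SW Sx)).
apply: expandsN; first exact: openT.
exact: (expands_nf openT oW cC (fint_fermat Su) (SW Su)).
Qed.

Lemma nf_primitive_fderiv c (f : (R -> R) -> R -> R) x :
  (forall e y, W y -> is_derive y 1 (C e) (c e y)) -> S x ->
  fequiv (f x) (fun t => nf bs c t (x t)) -> fderiv S nf_primitive x (f x).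
Proof.
move=> dC Sx fx; exists W, n.+1, setT, q, (linear_family Cs).
split; first exact: nf_primitive_rep.
apply: fequiv_trans fx _.
have d t y : W y -> nf bs c t y = derive1 (linear_family Cs (q t)) y.
  move=> Wy; rewrite (funext (linear_family_nf t)) derive1E.
  have h : is_derive y 1 (nf bs C t) (nf bs c t y).
    by apply: nf_is_derive => e _; exact: dC.
  have : is_derive y 1 (nf bs C t - cst (nf bs C t (u t))) (nf bs c t y - 0).
    by apply: is_deriveB.
  by rewrite subr0 => -[_ ->].
apply: fequiv_near; first by apply: d; exact: SW.
apply: filterS (fermat_in_open oW (fint_fermat Sx) (SW Sx)) => t.
exact: d.
Qed.

(* At an endpoint of [a 0, b 0] the difference of coefficients need not vanish
   outside the interval, but it is flat there, hence o(t) along Fermat reals. *)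
Lemma flat_on_fint (D : R -> R) (W' : set R) x : open W' -> smooth1 W' D -> S x -> W' (x 0) ->
  (forall y, a 0 < y < b 0 -> D y = 0) -> is_o (fun t => D (x t)).
Proof.
move=> oW' sD Sx Wx D0.
apply: (smooth1_flat_o oW' sD (fint_fermat Sx) Wx) => k.
have Dk y : oo (a 0) (b 0) y -> derive1n k D y = 0.
  have D0' z : oo (a 0) (b 0) z -> D z = cst 0 z by exact: D0.
  move=> yab; rewrite (derive1n_eq (@oo_open _ _ _) D0' _ yab).
  suff -> : derive1n k (cst (0 : R)) = cst 0 by [].
  elim: (k) => [//|k' IH]; rewrite derive1nS IH.
  by apply/funext => z; rewrite derive1_cst.
apply/eqP/negPn/negP => Dn0; have e0 : 0 < `|derive1n k D (x 0)| by rewrite normr_gt0.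
have := smooth1_continuous (k := k) sD Wx.
move=> /cvgrPdist_lt /(_ _ e0) /nbhs_ballP[d d0 hd].
have /andP[ax xb] := fint_bounds Sx.
pose L := b 0 - a 0; have L0 : 0 < L by rewrite subr_gt0.
(* The point y below goes a fraction la of the way from [x 0] to the midpoint: la > 0 puts it
   strictly inside, and la L < d keeps it in the ball where the derivative is nonzero. *)
have [la [la0 la1 laL]] : exists la, [/\ 0 < la, la < 1 & la * L < d].
  have dL : 0 < d + L by rewrite addr_gt0.
  exists (d / (d + L)); split; first by rewrite divr_gt0.
    by rewrite ltr_pdivrMr// mul1r ltrDl.
  by rewrite mulrAC ltr_pdivrMr// ltr_pM2l// ltrDr.
pose y := x 0 + la * ((a 0 + b 0) / 2 - x 0).
have yab : oo (a 0) (b 0) y.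
  have h1 : 0 <= (1 - la) * (x 0 - a 0) by rewrite mulr_ge0// subr_ge0// ltW.
  have h2 : 0 <= (1 - la) * (b 0 - x 0) by rewrite mulr_ge0// subr_ge0// ltW.
  have h3 : 0 < la * L by rewrite mulr_gt0.
  move: h1 h2 h3; rewrite /oo/= /y /L => h1 h2 h3; apply/andP; split; lra.
suff yd : ball (x 0) d y by have := hd y yd; rewrite /= (Dk _ yab) subr0 ltxx.
rewrite /ball/= /y opprD addrA subrr sub0r normrN normrM gtr0_norm//.
apply: le_lt_trans laL; apply: ler_wpM2l; first exact: ltW.
by rewrite ler_norml /L; lra.
Qed.

(** The representation witnessing the derivative has its own coefficients [c1]. Near s they equal c'
    by uniqueness for J; at s their derivatives equal c by uniqueness applied to the value of f at
    the constant s. *)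
Lemma nfrep_fderiv_eq c (f J : (R -> R) -> R -> R) l r bs' c' (s : R) :
  (forall x, S x -> fequiv (f x) (fun t => nf bs c t (x t))) -> coefs W bs c ->
  nfrep a b J (oo l r) bs' c' -> oo l r s -> a 0 < s < b 0 ->
  fderiv S J (fun=> s) (f (fun=> s)) -> forall e, derive1 (c' e) s = c e s.
Proof.
move=> hf cc nJ lrs sab [V [p [P [q' [al [rep fd]]]]]] e.
have Ss : S (fun=> s) := fint_cst fa fb sab.
have [d [bs1 [c1 [d0 n1 dn]]]] := nfrep_local Ss rep.
have -> : derive1 (c' e) s = derive1 (c1 e) s.
  (* Equality at s alone would not carry over to derivatives; an open set of common reals is
     needed. *)
  pose N := oo (a 0) (b 0) `&` (oo l r `&` ball s d).
  have oN : open N by do 2 (apply: openI; first exact: oo_open); exact: ball_open.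
  have eqN y : N y -> c' e y = c1 e y.
    move=> [yab [ylr yd]].
    exact: (nfrep_unique fa fb (@oo_open _ l r) (@ball_open _ _ s d) nJ n1).
  have Ns : N s by split=> //; split=> //; exact: ballxx.
  exact: (derive1n_eq oN eqN 1%N Ns).
have [[u1 p1 off1 s1] k1 _] := n1.
have cd1 : coefs (ball s d) bs1 (fun e => derive1 (c1 e)).
  split=> // [e' y e'n|e']; last exact: smooth1_derive1.
  have -> : c1 e' = cst 0 by apply/funext => z; exact: off1.
  exact: derive1_cst.
apply: (nf_fequiv_eq (ball_open s d) oW cd1 cc k1 le1).
apply: fequiv_trans (hf _ Ss); apply: fequiv_sym.
exact: fequiv_trans fd dn.
Qed.

(** Two primitives differ by a Fermat constant [kt], made of one real constant for each exponent;
    the condition at u removes it. *)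
Lemma nf_primitive_unique c (f J : (R -> R) -> R -> R) :
  (forall e y, W y -> is_derive y 1 (C e) (c e y)) -> coefs W bs c ->
  (forall x, S x -> fequiv (f x) (fun t => nf bs c t (x t))) ->
  fsmooth S J -> (forall x, S x -> fderiv S J x (f x)) ->
  fequiv (J u) (fun=> 0) -> forall x, S x -> fequiv (J x) (nf_primitive x).
Proof.
move=> dC cc hf sJ dJ Ju.
have [l [r [bs' [c' [la br nJ]]]]] := nfrep_global fa fb ab sJ.
have lrS y : a 0 <= y <= b 0 -> oo l r y.
  by move=> /andP[h1 h2]; rewrite /oo/= (lt_le_trans la)//= (le_lt_trans h2).
pose W' := oo l r `&` W; have oW' : open W' by apply: openI => //; exact: oo_open.
have WS y : a 0 <= y <= b 0 -> W y.
  by move=> /(fint_ex fa fb ab)[x Sx <-]; exact: SW.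
have ooS y : a 0 < y < b 0 -> a 0 <= y <= b 0 by move=> /andP[/ltW -> /ltW ->].
have [cf' k' hJ] := nJ; have [u1 p1 off1 s1] := cf'; have [u2 p2 off2 s2] := cC.
pose K e y := c' e y - C e y.
have sK e : smooth1 W' (K e).
  have s1' : smooth1 W' (c' e) by apply: smooth1_sub (s1 e) => y [].
  have s2' : smooth1 W' (C e) by apply: smooth1_sub (s2 e) => y [].
  have := smooth1D oW' s1' (smooth1Z (-1) oW' s2').
  by apply: smooth1_eq => // y _; rewrite mulN1r.
(* [derive_bound] needs the whole symmetric interval about its base point, with y on its rim, to
   stay in ]a 0, b 0[; the midpoint guarantees this for every y. *)
pose m := (a 0 + b 0) / 2; have mab : a 0 < m < b 0.
  by have h := ab; rewrite /m; apply/andP; split; lra.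
pose k e := K e m.
have Kk e y : a 0 < y < b 0 -> K e y = k e.
  move=> yab; apply/eqP; rewrite -subr_eq0 -normr_le0.
  rewrite -(mul0r `|y - m|); apply: (@derive_bound _ (K e) (fun=> 0)); last first.
    by move=> *; rewrite normr0.
  move=> z zy; have zab : a 0 < z < b 0.
    have mE : m + m = a 0 + b 0 by rewrite /m; lra.
    case/andP: yab => h1 h2; move: zy; rewrite ler_norml => /andP[].
    by have [h|h] := ger0P (y - m) => h3 h4; apply/andP; split; lra.
  have d1 : is_derive z 1 (c' e) (c e z).
    rewrite -(nfrep_fderiv_eq hf cc nJ (lrS _ (ooS _ zab)) zab (dJ _ (fint_cst fa fb zab)) e).
    exact: (smooth1_is_derive 0%N (s1 e) (lrS _ (ooS _ zab))).
  by rewrite -[0](subrr (c e z)); apply: is_deriveB; apply: dC; exact: WS (ooS _ zab).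
pose U := undup (bs' ++ bs).
have uU : uniq U by exact: undup_uniq.
pose kt t := \sum_(e <- U) k e * t `^ e.
have key x : S x -> fequiv (J x) (fun t => nf bs C t (x t) + kt t).
  move=> Sx; have xlr := lrS _ (fint_bounds Sx).
  apply: fequiv_trans (hJ x Sx xlr) _; apply/fequivP.
  suff : uo setT 1 (fun t _ => \sum_(e <- U) (K e (x t) - k e) * t `^ e).
    apply: uo_eq => t y _ _.
    rewrite -(@nf_subset _ bs' U c')//; last by move=> e' h; rewrite mem_undup mem_cat h.
    rewrite -(@nf_subset _ bs U C)//; last by move=> e' h; rewrite mem_undup mem_cat h orbT.
    rewrite opprD addrA /nf /kt -!sumrB; apply: eq_bigr => e _.
    by rewrite /K; ring.
  apply: (@uo_sum _ _ U setT 1 (fun e t _ => (K e (x t) - k e) * t `^ e)) => e eU.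
  have e0 : 0 <= e.
    by move: eU; rewrite mem_undup mem_cat => /orP[/p1|/p2].
  apply: uo_bounded.
    exists 1; apply: filterS2 (at0_ge0 R) (at0_lt ltr01) => t t0 /ltW t1 y _.
    by rewrite ger0_norm ?powR_ge0// powR_le1.
  apply/is_oE; apply: (@flat_on_fint (fun y => K e y - k e) W' x) => //.
  - have := smooth1D oW' (sK e) (smooth1_cst (- k e) oW').
    by apply: smooth1_eq.
  - by split=> //; exact: SW.
  - by move=> y /(Kk e) ->; rewrite subrr.
move=> x Sx.
(* By [key] at u and the condition on J u, the subtracted term is equivalent to 0. Written this way,
   [kt] cancels without being computed. *)
have J0 : fequiv (J x) (fun t => J x t - (nf bs C t (u t) + kt t)).
  have := fequivB (fequiv_refl (J x)) (fequiv_sym (fequiv_trans (fequiv_sym (key u Su)) Ju)).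
  by congr fequiv; apply/funext => t; rewrite subr0.
apply: fequiv_trans J0 _.
have := fequivB (key x Sx) (fequiv_refl (fun t => nf bs C t (u t) + kt t)).
by congr fequiv; apply/funext => t; rewrite /nf_primitive; ring.
Qed.

End Primitive.

Unset Implicit Arguments.
Set Strict Implicit.

Theorem theorem12 (R : realType) (a b u : R -> R) (f : (R -> R) -> R -> R) :
  fermat a -> fermat b -> a 0 < b 0 ->
  fsmooth (fint a b) f -> fint a b u ->
  exists I : (R -> R) -> R -> R,
    [/\ fsmooth (fint a b) I,
        (forall x, fint a b x -> fderiv (fint a b) I x (f x)),
        fequiv (I u) (fun _ => 0) &
        forall J : (R -> R) -> R -> R,
          fsmooth (fint a b) J ->
          (forall x, fint a b x -> fderiv (fint a b) J x (f x)) ->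
          fequiv (J u) (fun _ => 0) ->
          forall x, fint a b x -> fequiv (J x) (I x)].
Proof.
move=> fa fb ab sf Su.
have [l [r [bs [c [la br [cf le1 hf]]]]]] := nfrep_global fa fb ab sf.
have [u1 p1 off1 s1] := cf.
(* Halfway points: strictly inside ]l, r[, where primitives exist, yet beyond [a 0] and [b 0], so
   that W is a neighbourhood of all standard parts. *)
pose l' := (l + a 0) / 2; pose r' := (b 0 + r) / 2.
have ll' : l < l' by rewrite /l'; lra.
have la' : l' < a 0 by rewrite /l'; lra.
have rr' : r' < r by rewrite /r'; lra.
have br' : b 0 < r' by rewrite /r'; lra.
pose W := oo l' r'; have oW : open W by exact: oo_open.
have sW : W `<=` oo l r.
  by move=> y /andP[h1 h2]; rewrite /oo/= (lt_trans ll')//= (lt_trans h2).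
have SW x : fint a b x -> W (x 0).
  move=> /fint_bounds /andP[h1 h2].
  by rewrite /W/oo/= (lt_le_trans la')//= (le_lt_trans h2).
have prim e : exists C, forall y, l' < y < r' -> is_derive y 1 C (c e y).
  apply: (@continuous_primitive R (c e) l r) => // y yd.
  exact: (smooth1_continuous (k := 0%N) (s1 e) yd).
have [C0 hC0] := choice prim.
pose C e := if e \in bs then C0 e else fun=> 0.
have dC e y : W y -> is_derive y 1 (C e) (c e y).
  move=> Wy; rewrite /C; case eb: (e \in bs); first exact: hC0.
  by rewrite off1 ?eb//; exact: is_derive_cst.
have cW : coefs W bs c by apply: coefs_sub cf.
have cC : coefs W bs C.
  split=> // [e y en|e]; first by rewrite /C (negbTE en).
  case: cW => _ _ _ /(_ e) sc; exact: (smooth1_primitive oW sc (dC e)).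
have hf' x : fint a b x -> fequiv (f x) (fun t => nf bs c t (x t)).
  by move=> Sx; apply: hf => //; apply: sW; exact: SW.
exists (nf_primitive u bs C); split.
- exact: (nf_primitive_smooth Su oW cC SW).
- by move=> x Sx; exact: (nf_primitive_fderiv Su oW cC SW dC Sx (hf' x Sx)).
- apply: fequiv_near; first by rewrite /nf_primitive subrr.
  by apply: filterE => t; rewrite /nf_primitive subrr.
- move=> J sJ dJ Ju x Sx.
  exact: (nf_primitive_unique fa fb ab Su oW cC le1 SW dC cW hf' sJ dJ Ju Sx).
Qed.
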